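(* Let $S=\mathbb{C}^2$ with the action of the one-dimensional torus $\mathsf{T}_0=\{(t_1,t_2):t_1t_2=1\}$. The equivariant reduced Segre, Verlinde and Chern series for $E=\bigoplus_{i=1}^N\mathcal{O}_S\langle y_i\rangle$ and $\alpha\in K_{\mathsf{T}}(S)$ are $$\mathcal{S}^{\mathrm{red}}(E,\alpha;q)=\sum_{\mu,\nu,\xi}\log\left(A_{\mu,\nu,\xi}(q)\right)\cdot\int_Sc_\mu(\alpha)c_\nu(S)c_\xi(E),$$ $$\mathcal{V}^{\mathrm{red}}(E,\alpha;q)=\sum_{\mu,\nu,\xi}\log\left(B_{\mu,\nu,\xi}(q)\right)\cdot\int_Sc_\mu(\alpha)c_\nu(S)c_\xi(E),$$ $$\mathcal{C}^{\mathrm{red}}(E,\alpha;q)=\sum_{\mu,\nu,\xi}\log\left(C_{\mu,\nu,\xi}(q)\right)\cdot\int_Sc_\mu(\alpha)c_\nu(S)c_\xi(E),$$ where the sums are over all triples of partitions and $A_{\mu,\nu,\xi},B_{\mu,\nu,\xi},C_{\mu,\nu,\xi}$ are the universal series (for $N$ and $r=\operatorname{rank}\alpha$) of the non-reduced equivariant virtual Segre, Verlinde and Chern series of $\operatorname{Quot}_S(E,n)$ for the full two-dimensional torus.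
   Context: Non-reduced setup. $\mathsf{T}=\mathsf{T}_0\times\mathsf{T}_1\times\mathsf{T}_2$, where first $\mathsf{T}_0=(\mathbb{C}^* )^2$ (coordinates $t_1,t_2$) acts naturally on $S=\mathbb{C}^2$ with tangent weights $t_1,t_2$ at the origin, $\mathsf{T}_1=(\mathbb{C}^* )^N$ has coordinates $y_i$, $\mathsf{T}_2$ has coordinates $v_1,v_2,\dots$; $\mathsf{T}_1,\mathsf{T}_2$ act trivially on $S$. $\lambda_i,m_i,w_i$ are the equivariant first Chern classes of $t_i,y_i,v_i$; weights are identified with their Chern characters ($t_i=e^{\lambda_i}$, etc.). $\mathcal{O}_S\langle\chi\rangle$ is the trivial line bundle with character $\chi$. A class $\alpha$ of rank $r$ is $\alpha=[\bigoplus_{i\le a}\mathcal{O}_S\langle v_i\rangle]-[\bigoplus_{a<i\le a+b}\mathcal{O}_S\langle v_i\rangle]$, $a-b=r$, with $v_i$ generic parameters (which may be specialized to arbitrary $\mathsf{T}$-characters). $c(\alpha)=\prod_{i\le a}(1+w_i)/\prod_{i>a}(1+w_i)$, $c(E)=\prod(1+m_i)$, $c(S)=(1+\lambda_1)(1+\lambda_2)$, $\int_S\gamma=\gamma/(\lambda_1\lambda_2)$; $c_\mu(\cdot)=\prod_ic_{\mu_i}(\cdot)$, equal to $1$ for the empty partition $(0)$. The $\mathsf{T}$-fixed points $Z_\pi$ of $\operatorname{Quot}_S(E,n)$ (zero-dimensional length $n$ quotients of $E$) are indexed by $N$-tuples of partitions $\pi=(\pi^{(1)},\dots,\pi^{(N)})$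 of total size $|\pi|=n$. With boxes $\{(i,j)\in\mathbb{Z}_{\ge0}^2:j<\rho_{i+1}\}$ for a partition $\rho$ and $Q_k=\sum_{(i,j)\in\pi^{(k)}}t_1^{-j}t_2^{-i}$: $T^{\mathrm{vir}}_{Z_\pi}=\sum_{k,l}(Q_l-(1-t_1)(1-t_2)\overline{Q_k}Q_l)y_k^{-1}y_l$ (bar inverts $t_1,t_2$), $\alpha^{[n]}|_{Z_\pi}=\sum_k(\sum_{i\le a}v_i-\sum_{i>a}v_i)y_kQ_k$. For a virtual character $\gamma=\sum n_\chi\chi$: $e(\gamma)=\prod c_1(\chi)^{n_\chi}$, $c(\gamma)=\prod(1+c_1(\chi))^{n_\chi}$, $s(\gamma)=c(\gamma)^{-1}$, $\det\gamma=\prod\chi^{n_\chi}$, $\operatorname{ch}(\Lambda_{-1}\gamma^\vee)=\prod(1-\chi^{-1})^{n_\chi}$. Set $\mathcal{S}_S=\sum_\pi q^{|\pi|}\frac{s(\alpha^{[n]}|_{Z_\pi})}{e(T^{\mathrm{vir}}_{Z_\pi})}$, $\mathcal{C}_S=\sum_\pi q^{|\pi|}\frac{c(\alpha^{[n]}|_{Z_\pi})}{e(T^{\mathrm{vir}}_{Z_\pi})}$, $\mathcal{V}_S=\sum_\pi q^{|\pi|}\frac{\operatorname{ch}(\det\alpha^{[n]}|_{Z_\pi})}{\operatorname{ch}(\Lambda_{-1}(T^{\mathrm{vir}}_{Z_\pi})^\vee)}$. Universal series. $A_{\mu,\nu,\xi},B_{\mu,\nu,\xi},C_{\mu,\nu,\xi}\in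 1+q\,\mathbb{C}[\![q]\!]$ are the series depending only on $N,r$ for which, for all $\alpha$ of rank $r$, $\mathcal{S}_S(E,\alpha;q)=\prod_{\mu,\nu,\xi}A_{\mu,\nu,\xi}(q)^{\int_Sc_\mu(\alpha)c_\nu(S)c_\xi(E)c_1(S)}$, and likewise $\mathcal{V}_S$ with $B$ and $\mathcal{C}_S$ with $C$ (read degree by degree in $\vec\lambda,\vec m,\vec w$). Their existence is known. Reduced invariants. Now restrict to $\mathsf{T}_0=\{t_1t_2=1\}$, so $\lambda_1=\lambda=-\lambda_2$, $c_1(S)=0$, $\int_S\gamma=\gamma/(-\lambda^2)$. The fixed points are unchanged; put $T^{\mathrm{red}}_{Z_\pi}=T^{\mathrm{vir}}_{Z_\pi}+1$ (in K-theory modulo $t_1t_2=1$). Then $$\mathcal{S}^{\mathrm{red}}=\sum_{|\pi|>0}q^{|\pi|}\frac{s(\alpha^{[n]}|_{Z_\pi})}{e(T^{\mathrm{red}}_{Z_\pi})},\quad\mathcal{C}^{\mathrm{red}}=\sum_{|\pi|>0}q^{|\pi|}\frac{c(\alpha^{[n]}|_{Z_\pi})}{e(T^{\mathrm{red}}_{Z_\pi})},\quad\mathcal{V}^{\mathrm{red}}=\sum_{|\pi|>0}q^{|\pi|}\frac{\operatorname{ch}(\det\alpha^{[n]}|_{Z_\pi})}{\operatorname{ch}(\Lambda_{-1}(T^{\mathrm{red}}_{Z_\pi})^\vee)},$$ where a fixed point at which $T^{\mathrm{red}}$ has the trivial weight with negative multiplicity contributes $0$. Infinite sums are read degree by degree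 in $\lambda,\vec m,\vec w$. *)

(* Defs.v *)
From HB Require Import structures.
From mathcomp Require Import all_boot all_order all_algebra.
From mathcomp Require Import finmap mathcomp_extra boolp classical_sets.
From mathcomp Require Import functions cardinality fsbigop reals complex.
From mathcomp Require Import freeg mpoly.

Set Implicit Arguments.
Unset Strict Implicit.
Unset Printing Implicit Defensive.

Import Order.TTheory GRing.Theory Num.Theory.
Local Open Scope ring_scope.
Local Notation "x %:F" := (tofrac x).

Record fps (R : Type) := Fps { coefS : nat -> R }.

Lemma fpsP (R : Type) (f g : fps R) : coefS f =1 coefS g <-> f = g.
Proof.
split=> [|-> //]; case: f g => [f] [g] /= fg; congr Fps; exact: funext.
Qed.

HB.instance Definition _ (R : Type) := gen_eqMixin (fps R).
HB.instance Definition _ (R : Type) := gen_choiceMixin (fps R).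

Section FpsRing.
Variable R : comNzRingType.
Implicit Types f g h : fps R.

Definition addS f g := Fps (fun n => coefS f n + coefS g n).
Definition oppS f := Fps (fun n => - coefS f n).
Definition constS (c : R) := Fps (fun n => c *+ (n == 0)%N).
Definition mulS f g :=
  Fps (fun n => \sum_(i < n.+1) coefS f i * coefS g (n - i)).

Fact addSA : associative addS.
Proof. by move=> f g h; apply/fpsP => n /=; rewrite addrA. Qed.
Fact addSC : commutative addS.
Proof. by move=> f g; apply/fpsP => n /=; rewrite addrC. Qed.
Fact add0S : left_id (constS 0) addS.
Proof. by move=> f; apply/fpsP => n /=; rewrite mul0rn add0r. Qed.
Fact addNS : left_inverse (constS 0) oppS addS.
Proof. by move=> f; apply/fpsP => n /=; rewrite mul0rn addNr. Qed.

HB.instance Definition _ :=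
  GRing.isZmodule.Build (fps R) addSA addSC add0S addNS.

Fact mulS_rev f g n :
  coefS (mulS f g) n = \sum_(i < n.+1) coefS f (n - i) * coefS g i.
Proof.
rewrite /= (reindex_inj rev_ord_inj) /=.
by apply: eq_bigr => i _; rewrite subSS subKn -1?ltnS.
Qed.

Fact mulSC : commutative mulS.
Proof.
move=> f g; apply/fpsP => n; rewrite mulS_rev /=.
by apply: eq_bigr => i _; rewrite mulrC.
Qed.

Fact mulSA : associative mulS.
Proof.
move=> f g h; apply/fpsP => i; rewrite [RHS]mulS_rev.
pose coef3 j k := coefS f j * (coefS g (i - j - k) * coefS h k).
transitivity (\sum_(j < i.+1) \sum_(k < i.+1 | (k <= i - j)%N) coef3 j k).
  apply: eq_bigr => j _; rewrite [X in _ * X]mulS_rev big_distrr /=.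
  by rewrite (big_ord_narrow_leq (leq_subr _ _)).
rewrite (exchange_big_dep predT) //=; apply: eq_bigr => k _.
transitivity (\sum_(j < i.+1 | (j <= i - k)%N) coef3 j k).
  apply: eq_bigl => j; rewrite -ltnS -(ltnS j) -!subSn ?leq_ord //.
  by rewrite -subn_gt0 -(subn_gt0 j) -!subnDA addnC.
rewrite (big_ord_narrow_leq (leq_subr _ _)) big_distrl /=.
by apply: eq_bigr => j _; rewrite /coef3 -!subnDA addnC mulrA.
Qed.

Fact mul1S : left_id (constS 1) mulS.
Proof.
move=> f; apply/fpsP => n /=; rewrite big_ord_recl subn0 mul1r.
by rewrite big1 ?addr0 // => i _; rewrite mul0r.
Qed.

Fact mulSDl : left_distributive mulS addS.
Proof.
move=> f g h; apply/fpsP => n /=; rewrite -big_split /=.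
by apply: eq_bigr => i _; rewrite mulrDl.
Qed.

Fact oneS_neq0 : constS 1 != 0.
Proof. by apply/eqP => /fpsP/(_ 0%N) /eqP; rewrite /= oner_eq0. Qed.

HB.instance Definition _ := GRing.Zmodule_isComNzRing.Build (fps R)
  mulSA mulSC mul1S mulSDl oneS_neq0.

Definition unitS : {pred fps R} := fun f => `[< exists g, g * f = 1 >].
Definition invS f : fps R :=
  if pselect (exists g, g * f = 1) is left e then projT1 (cid e) else f.

Fact mulVS : {in unitS, left_inverse 1 invS *%R}.
Proof.
move=> f /asboolP fu; rewrite /invS; case: pselect => // e.
by case: (cid e).
Qed.
Fact unitSP f g : g * f = 1 -> unitS f.
Proof. by move=> gf; apply/asboolP; exists g. Qed.
Fact invS_out : {in [predC unitS], invS =1 id}.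
Proof.
move=> f /asboolP fu; rewrite /invS; case: pselect => // e.
Qed.

HB.instance Definition _ := GRing.ComNzRing_hasMulInverse.Build (fps R)
  mulVS unitSP invS_out.

Lemma coefSD f g n : coefS (f + g) n = coefS f n + coefS g n.
Proof. by []. Qed.
Lemma coefSN f n : coefS (- f) n = - coefS f n.
Proof. by []. Qed.
Lemma coefSM f g n :
  coefS (f * g) n = \sum_(i < n.+1) coefS f i * coefS g (n - i).
Proof. by []. Qed.
Lemma coefS0 n : coefS (0 : fps R) n = 0.
Proof. exact: mul0rn. Qed.
Lemma coefS1 n : coefS (1 : fps R) n = (n == 0%N)%:R.
Proof. by []. Qed.
End FpsRing.

Section FpsUnits.
Variable R : comUnitRingType.
Implicit Types f g h : fps R.

Lemma constSM (c : R) f n : coefS (constS c * f) n = c * coefS f n.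
Proof.
rewrite coefSM big_ord_recl subn0 big1 ?addr0 // => i _.
by rewrite /= mulr0n mul0r.
Qed.

Lemma coefSX_lt h m n : coefS h 0 = 0 -> (n < m)%N -> coefS (h ^+ m) n = 0.
Proof.
move=> h0; elim: m n => // m IH n nm; rewrite exprS coefSM big1 // => -[i le_i] _ /=.
case: i le_i => [|i] le_i; first by rewrite h0 mul0r.
by rewrite IH ?mulr0 // ltn_subLR // addSn; apply: leq_trans nm _; rewrite ltnS leq_addl.
Qed.

Lemma coefS_sum I (s : seq I) (F : I -> fps R) n :
  coefS (\sum_(i <- s) F i) n = \sum_(i <- s) coefS (F i) n.
Proof.
by elim: s => [|i s IH]; rewrite ?big_nil ?coefS0 // !big_cons coefSD IH.
Qed.

Lemma unitSE f : (f \is a GRing.unit) = (coefS f 0 \is a GRing.unit).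
Proof.
have hom g h : coefS (g * h) 0 = coefS g 0 * coefS h 0.
  by rewrite coefSM big_ord_recl big_ord0 addr0.
apply/idP/idP => [fu | fu].
  apply/unitrP; exists (coefS f^-1 0).
  by rewrite -!hom mulVr // divrr // coefS1.
set a := coefS f 0 in fu.
pose h : fps R := 1 - constS a^-1 * f.
have h0 : coefS h 0 = 0.
  by rewrite coefSD coefSN constSM coefS1 mulVr // subrr.
pose g := Fps (fun n => \sum_(k < n.+1) coefS (h ^+ k) n).
have gE n m : (m <= n)%N -> coefS g m = coefS (\sum_(k < n.+1) h ^+ k) m.
  move=> mn; rewrite coefS_sum /= (big_ord_widen n.+1 (fun k => coefS (h ^+ k) m)) //.
  rewrite [RHS](bigID (fun k : 'I_n.+1 => (k < m.+1)%N)) /=.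
  rewrite [X in _ + X]big1 ?addr0 // => i; rewrite -leqNgt => mi.
  exact: coefSX_lt.
have hg : (1 - h) * g = 1.
  apply/fpsP => n; transitivity (coefS ((1 - h) * \sum_(k < n.+1) h ^+ k) n).
    by apply: eq_bigr => i _; congr (_ * _); apply: gE; rewrite leq_subr.
  by rewrite -opprB mulNr -subrX1 opprB coefSD coefSN coefSX_lt ?subr0.
rewrite opprB addrCA subrr addr0 in hg.
by apply/unitrPr; exists (constS a^-1 * g); rewrite mulrCA mulrA.
Qed.
End FpsUnits.

Section FpsDomain.
Variable R : idomainType.

Fact mulS_eq0 (f g : fps R) : f * g = 0 -> (f == 0) || (g == 0).
Proof.
have low (h : fps R) : h != 0 ->
    exists2 m, coefS h m != 0 & forall i, (i < m)%N -> coefS h i = 0.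
  move=> h0; have ex : exists m, coefS h m != 0.
    apply: contrapT => nex; case/eqP: h0; apply/fpsP => m.
    by rewrite coefS0; apply: contrapT => /eqP hm; apply: nex; exists m.
  case: (ex_minnP ex) => m hm mmin; exists m => // i im.
  by apply: contraTeq im => /mmin; rewrite -leqNgt.
move=> fg0; apply/negP => /negP; rewrite negb_or => /andP[/low[m fm mf]].
move=> /low[n gn ng]; have /fpsP/(_ (m + n)%N) := fg0.
rewrite coefS0 coefSM (bigD1 (inord m)) //= inordK ?ltnS ?leq_addr //.
rewrite addKn big1 ?addr0; first by apply/eqP; rewrite mulf_neq0.
move=> i; rewrite -val_eqE /= inordK ?ltnS ?leq_addr // neq_ltn.
case/orP => [/mf-> | mi]; first by rewrite mul0r.
by rewrite ng ?mulr0 // ltn_subLR ?ltn_add2r // -ltnS.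
Qed.

HB.instance Definition _ :=
  GRing.ComUnitRing_isIntegral.Build (fps R) mulS_eq0.
End FpsDomain.

Section FpsFunctions.
Variable K : fieldType.
Implicit Types f : fps K.

Definition monS (c : K) (d : nat) : fps K := Fps (fun n => c *+ (n == d)).

(* The truncations at [k <= n] are exact when [coefS f 0 = 0] (for [expS]),
   resp. [coefS f 0 = 1] (for [logS]). *)
Definition expS f : fps K :=
  Fps (fun n => \sum_(0 <= k < n.+1) coefS (f ^+ k) n / k`!%:R).
Definition logS f : fps K :=
  Fps (fun n =>
    \sum_(1 <= k < n.+1) (-1) ^+ k.+1 * coefS ((f - 1) ^+ k) n / k%:R).
Definition powS f (x : K) : fps K := expS (constS x * logS f).
End FpsFunctions.

Definition mapS (R R' : Type) (u : R -> R') (f : fps R) : fps R' :=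
  Fps (u \o coefS f).

Record partition := Partition {
  parts :> seq nat;
  partsP : sorted geq parts && (0%N \notin parts) }.

HB.instance Definition _ := [isSub for parts].
HB.instance Definition _ := [Choice of partition by <:].

Definition psize (mu : partition) : nat := sumn mu.

Definition mpsize N (pi : N.-tuple partition) : nat :=
  \sum_(k < N) psize (tnth pi k).

Definition triple := (partition * partition * partition)%type.
Definition tsize (p : triple) : nat :=
  psize p.1.1 + psize p.1.2 + psize p.2.

Lemma finite_psize n : finite_set [set mu : partition | (psize mu <= n)%N].
Proof.
pose s := flatten [seq [seq [seq val x | x <- tval u] | u : m.-tuple 'I_n.+1]
                       | m <- iota 0 n.+1].
apply: (@sub_finite_set _ _ (parts @^-1` [set` s])); last first.
  by apply: finite_preimage (finite_seq s) => x y _ _; exact: val_inj.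
move=> [mu muP]; have /andP[_ mu0] := muP; rewrite /psize /= => mun.
have le_n x : x \in mu -> (x < n.+1)%N.
  move=> xmu; rewrite ltnS (leq_trans _ mun) // sumnE (big_rem x) //=.
  exact: leq_addr.
have sz : (size mu <= n)%N.
  apply: leq_trans mun; elim: mu mu0 {le_n muP} => //= x mu IH.
  rewrite inE negb_or eq_sym -lt0n => /andP[x0 /IH le_mu].
  by rewrite -add1n leq_add.
apply/flatten_mapP; exists (size mu); first by rewrite mem_iota.
have tP : size [seq inord x : 'I_n.+1 | x <- mu] == size mu by rewrite size_map.
apply/fintype.imageP; exists (Tuple tP) => //=.
rewrite -map_comp -[LHS]map_id; apply/eq_in_map => x /le_n xn /=.
by rewrite inordK.
Qed.

Lemma finite_mpsize N n :
  finite_set [set pi : N.-tuple partition | mpsize pi = n].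
Proof.
have /finite_seqP[s sE] := finite_psize n.
pose g (u : N.-tuple (seq_sub s)) : N.-tuple partition :=
  map_tuple (@ssval _ s) u.
apply: (@sub_finite_set _ _ (g @` setT)); last by apply: finite_image; exact: finite_finset.
move=> pi /= pin.
have mem k : tnth pi k \in s.
  have : ([set` s] (tnth pi k))%classic by rewrite -sE /= -pin /mpsize (bigD1 k) //= leq_addr.
  by [].
exists [tuple SeqSub (mem k) | k < N] => //.
by apply: eq_from_tnth => k; rewrite tnth_map tnth_mktuple.
Qed.

Lemma finite_tsize n : finite_set [set p : triple | (tsize p <= n)%N].
Proof.
have fin := finite_psize n.
apply: (sub_finite_set _ (finite_setX (finite_setX fin fin) fin)).
move=> [[mu nu] xi]; rewrite /tsize /= => le_n; split=> /=; first split=> /=.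
- by apply: leq_trans le_n; rewrite -addnA leq_addr.
- by apply: leq_trans le_n; rewrite addnAC leq_addl.
- by apply: leq_trans le_n; rewrite leq_addl.
Qed.

(* A character of a torus of rank [k] is its exponent vector, so the product of characters is the sum
   in ['rV[int]_k], and the representation ring is the free abelian group
   on characters; it is also K_T(S), as S is equivariantly contractible.  A
   class of rank r is an element of degree r, and the trivial character is 0. *)

Notation vchar k := {freeg 'rV[int]_k / int}.

Section VirtualCharacters.
Variable k : nat.
Implicit Types (chi : 'rV[int]_k) (g h : vchar k).

Definition chr chi : vchar k := << chi >>.

Definition vmul g h : vchar k :=
  \sum_(x <- dom g) \sum_(y <- dom h) << coeff x g * coeff y h *g x + y >>.

Definition vbar g : vchar k := \sum_(x <- dom g) << coeff x g *g - x >>.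

Definition vdet g : 'rV[int]_k := \sum_(x <- dom g) x *~ coeff x g.
End VirtualCharacters.

(* Equivariant parameters live in the field of rational functions in the first
   Chern classes of the coordinates.  The grading variable of [fps] records the
   cohomological degree: a class whose component of degree d is x_d is the
   Laurent series \sum_d x_d b^d, i.e. every first Chern class is multiplied
   by b. *)

Section Classes.
Variables (R : realType) (k : nat).
Implicit Types (chi : 'rV[int]_k) (g : vchar k).

Definition ratfun := {fraction {mpoly R[i][k]}}.
Definition laurent := {fraction (fps ratfun)}.

Definition cst (z : R[i]) : laurent := (constS (z%:MP_[k])%:F)%:F.

Definition c1 chi : ratfun := \sum_(i < k) ('X_i : {mpoly R[i][k]})%:F *~ chi 0 i.

Definition c1b chi : fps ratfun := monS (c1 chi) 1.

Definition ctot g : fps ratfun := \prod_(x <- dom g) (1 + c1b x) ^ coeff x g.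

(* The component of degree [i] of the total Chern class, placed in degree [i]. *)
Definition chern_class (i : nat) g : laurent := (monS (coefS (ctot g) i) i)%:F.

Definition chern_part (mu : partition) g : laurent :=
  \prod_(i <- parts mu) chern_class i g.

Definition chern g : laurent := (ctot g)%:F.
Definition segre g : laurent := (chern g)^-1.

Definition euler g : laurent := \prod_(x <- dom g) (c1b x)%:F ^ coeff x g.

Definition ch_char chi : laurent := (expS (c1b chi))%:F.

Definition ch_det g : laurent := ch_char (vdet g).

Definition ch_Lambda g : laurent :=
  \prod_(x <- dom g) (1 - ch_char (- x)) ^ coeff x g.

(* Convergence degree by degree: for each power of q, in the b-adic topology. *)
Definition deg_cvg (u : nat -> laurent) (l : laurent) : Prop :=
  forall d : nat, exists D0 : nat, forall D : nat, (D0 <= D)%N ->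
    exists f : fps ratfun, u D - l = (monS 1 d * f)%:F.

Definition qdeg_cvg (u : nat -> fps laurent) (l : fps laurent) : Prop :=
  forall n : nat, deg_cvg (fun D => coefS (u D) n) (coefS l n).
End Classes.

Record weights (N k : nat) := Weights {
  wt1 : 'rV[int]_k;
  wt2 : 'rV[int]_k;
  wy : 'I_N -> 'rV[int]_k }.

(* Coordinates (t1, t2, y_1, .., y_N, v_1, .., v_M). *)
Definition full_torus (N M : nat) : weights N (2 + N + M) :=
  Weights (delta_mx 0 (lshift M (lshift N (0 : 'I_2))))
          (delta_mx 0 (lshift M (lshift N (1 : 'I_2))))
          (fun i => delta_mx 0 (lshift M (rshift 2 i))).

(* The subtorus t1 t2 = 1, with coordinates (t1, y_1, .., y_N, v_1, .., v_M). *)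
Definition cy_torus (N M : nat) : weights N (1 + N + M) :=
  Weights (delta_mx 0 (lshift M (lshift N (0 : 'I_1))))
          (- delta_mx 0 (lshift M (lshift N (0 : 'I_1))))
          (fun i => delta_mx 0 (lshift M (rshift 1 i))).

Section Localization.
Variables (N k : nat) (W : weights N k).
Implicit Types (alpha : vchar k) (pi : N.-tuple partition).

Definition tangent_S : vchar k := chr (wt1 W) + chr (wt2 W).
Definition bundle_E : vchar k := \sum_(i < N) chr (wy W i).

(* The boxes of [rho] are the (i, j) with j < nth 0 rho i, and (i, j) has
   character t1^-j t2^-i. *)
Definition boxes (rho : partition) : vchar k :=
  \sum_(i < size rho) \sum_(j < nth 0%N rho i)
    chr (- (wt1 W *+ j) - wt2 W *+ i).

Definition Tvir pi : vchar k :=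
  let Q i := boxes (tnth pi i) in
  \sum_(i < N) \sum_(j < N)
    vmul (Q j - vmul (vmul (chr 0 - chr (wt1 W)) (chr 0 - chr (wt2 W)))
                     (vmul (vbar (Q i)) (Q j)))
         (chr (wy W j - wy W i)).

Definition Tred pi : vchar k := Tvir pi + chr 0.

Definition taut alpha pi : vchar k :=
  \sum_(i < N) vmul alpha (vmul (chr (wy W i)) (boxes (tnth pi i))).

Variable R : realType.
Local Notation L := (laurent R k).

Definition vir_series (num den : vchar k -> L) alpha : fps L :=
  Fps (fun n => \sum_(pi \in [set pi : N.-tuple partition | mpsize pi = n]%classic)
    num (taut alpha pi) / den (Tvir pi)).

(* A negative multiplicity of the trivial weight in T^red makes 1 / e(T^red)
   vanish; this is made explicit rather than left to [0^-1 = 0]. *)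
Definition red_series (num den : vchar k -> L) alpha : fps L :=
  Fps (fun n => if n == 0%N then 0 else
    \sum_(pi \in [set pi : N.-tuple partition | mpsize pi = n]%classic)
      if coeff 0 (Tred pi) < 0 then 0
      else num (taut alpha pi) / den (Tred pi)).

Definition Svir := vir_series (@segre R k) (@euler R k).
Definition Cvir := vir_series (@chern R k) (@euler R k).
Definition Vvir := vir_series (@ch_det R k) (@ch_Lambda R k).

Definition Sred := red_series (@segre R k) (@euler R k).
Definition Cred := red_series (@chern R k) (@euler R k).
Definition Vred := red_series (@ch_det R k) (@ch_Lambda R k).

Definition intS (x : L) : L := x / ((c1b R (wt1 W))%:F * (c1b R (wt2 W))%:F).

Definition chern_triple alpha (p : triple) : L :=
  chern_part R p.1.1 alpha * chern_part R p.1.2 tangent_S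
    * chern_part R p.2 bundle_E.
End Localization.

Section Universal.
Variables (R : realType) (N : nat).

Definition coef_family := partition -> partition -> partition -> fps R[i].

Definition at_triple (A : coef_family) (p : triple) : fps R[i] :=
  A p.1.1 p.1.2 p.2.

(* F = \prod_(mu, nu, xi) A_(mu, nu, xi) ^ \int_S c_mu(alpha) c_nu(S) c_xi(E) c_1(S) *)
Definition universal_product k (W : weights N k) (alpha : vchar k)
    (A : coef_family) (F : fps (laurent R k)) : Prop :=
  qdeg_cvg (fun D =>
    \big[*%R/1]_(p \in [set p : triple | (tsize p <= D)%N]%classic)
      powS (mapS (@cst R k) (at_triple A p))
        (intS W (chern_triple W R alpha p * chern_class R 1 (tangent_S W)))) F.

(* F = \sum_(mu, nu, xi) log A_(mu, nu, xi) * \int_S c_mu(alpha) c_nu(S) c_xi(E) *)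
Definition universal_log_sum k (W : weights N k) (alpha : vchar k)
    (A : coef_family) (F : fps (laurent R k)) : Prop :=
  qdeg_cvg (fun D =>
    \sum_(p \in [set p : triple | (tsize p <= D)%N]%classic)
      mapS (@cst R k) (logS (at_triple A p))
        * constS (intS W (chern_triple W R alpha p))) F.

Definition is_universal (r : int) (A : coef_family)
    (series : forall k, weights N k -> vchar k -> fps (laurent R k)) : Prop :=
  (forall mu nu xi, coefS (A mu nu xi) 0 = 1) /\
  (forall (M : nat) (alpha : vchar (2 + N + M)), deg alpha = r ->
    universal_product (full_torus N M) alpha A (series _ (full_torus N M) alpha)).
End Universal.

(* Main.v *)
Require Import Defs.
From HB Require Import structures.
From mathcomp Require Import all_boot all_order all_algebra.
From mathcomp Require Import reals complex freeg mpoly.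
From mathcomp Require Import ring.
From mathcomp Require Import finmap boolp classical_sets cardinality fsbigop.

Set Implicit Arguments.
Unset Strict Implicit.
Unset Printing Implicit Defensive.

Import Order.TTheory GRing.Theory Num.Theory.
Local Open Scope ring_scope.
Local Notation "x %:F" := (tofrac x).

(** Write [t1t2] for the character [t1 t2] of the full torus and
    [e = (lambda1 + lambda2) b] for its first Chern class; [e] is also [c_1(S)],
    and it generates the ideal of the subtorus [t1 t2 = 1].

    Taking logarithms of the product formula over the full torus gives
    [log S = e * H], where [H] is the sum over triples of
    [log A * \int_S c_mu c_nu c_xi].  Each graded piece of [H] is regular along
    [lambda1 + lambda2 = 0], and its restriction is the right-hand side of the
    reduced formula.  On the other side, every positive-degree coefficient of the
    non-reduced series is divisible by [e], and its quotient by [e] restricts to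
    the coefficient of the reduced series ([specL_series]).  Modulo [e] one has
    [(exp (e * H) - 1) / e = H], so both restrictions agree.

    The divisibility is local at each fixed point.  In
    [T = Q - (1 - t1)(1 - t2) Q^* Q] the power [(t1 t2)^a] occurs with
    multiplicity [-1] if [a >= 1] and the diagonal box [(a - 1, a - 1)] lies in
    the partition, and [0] otherwise ([coeff_Tvir]).  A
    nonempty fixed point therefore carries at least one factor [t1 t2] in the
    denominator of [e(T)]: if it is the only weight trivial on the subtorus,
    [1 / e(T)] is [e] times [1 / e(T^red)]; otherwise [1 / e(T)] vanishes to
    order at least two, and [T^red] has a negative multiplicity of the trivial
    weight ([specL_inv_mulext]).

    Restriction to the subtorus is only defined on rational functions without
    pole there, so it is handled as a relation, [specK] on rational functions and
    [specL] on Laurent series in [b], which is compatible with the field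
    operations and single-valued at [0].  No limit of restrictions has to be
    taken: for every truncation of the universal product, [specL_exp_quotient]
    restricts the quotient by [e] exactly, and [specL_small] shows that an error
    divisible by a power of [b] restricts to an error divisible by that power. *)

(** * Virtual characters *)

Section LinearExtension.
Variables (k : nat) (V : zmodType).
Implicit Types (f : 'rV[int]_k -> V) (g h : vchar k).

Definition linext f g : V := \sum_(x <- dom g) f x *~ coeff x g.

(** Summing over any duplicate-free superset of the support lets two virtual
    characters be compared over a common index set. *)
Lemma linext_widen f g (s : seq 'rV[int]_k) :
  uniq s -> {subset dom g <= s} -> linext f g = \sum_(x <- s) f x *~ coeff x g.
Proof.
move=> us sub; rewrite [RHS](bigID (mem (dom g))) /= [X in _ + X]big1 ?addr0; last first.
  by move=> x nx; rewrite coeff_outdom.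
rewrite -[RHS]big_filter; apply: perm_big; apply: uniq_perm => [||x].
- exact: uniq_dom.
- exact: filter_uniq.
- by rewrite mem_filter andb_idr // => /sub.
Qed.

Lemma linextD f g h : linext f (g + h) = linext f g + linext f h.
Proof.
pose s := undup (dom g ++ dom h).
have us : uniq s := undup_uniq _.
rewrite !(@linext_widen f _ s) // -?big_split /=; first 1 last.
- by move=> x xs; rewrite mem_undup mem_cat xs orbT.
- by move=> x xs; rewrite mem_undup mem_cat xs.
- by move=> x /domD_subset; rewrite mem_undup.
by apply: eq_bigr => x _; rewrite coeffD mulrzDr.
Qed.

Lemma linext0 f : linext f 0 = 0.
Proof. by rewrite /linext dom0 big_nil. Qed.

Lemma linextN f g : linext f (- g) = - linext f g.
Proof.
by apply: (addrI (linext f g)); rewrite -linextD !subrr linext0.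
Qed.

Lemma linext_sum f I (s : seq I) (P : pred I) (G : I -> vchar k) :
  linext f (\sum_(i <- s | P i) G i) = \sum_(i <- s | P i) linext f (G i).
Proof. by apply: (big_morph _ (@linextD f) (linext0 f)). Qed.

Lemma linextU f x : linext f (chr x) = f x.
Proof. by rewrite /linext /chr domU1 big_seq1 coeffU eqxx mulr1. Qed.

Lemma eq_linext f1 f2 g : f1 =1 f2 -> linext f1 g = linext f2 g.
Proof. by move=> e; apply: eq_bigr => x _; rewrite e. Qed.

Lemma linext_split f1 f2 g :
  linext (fun x => f1 x + f2 x) g = linext f1 g + linext f2 g.
Proof. by rewrite /linext -big_split; apply: eq_bigr => x _; rewrite mulrzDl. Qed.

Lemma linext_opp f g : linext (fun x => - f x) g = - linext f g.
Proof. by rewrite /linext -sumrN; apply: eq_bigr => x _; rewrite mulNrz. Qed.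
End LinearExtension.

Section Additive.
Variable k : nat.
Implicit Types (g h : vchar k).

Lemma freegU_chr c (x : 'rV[int]_k) : << c *g x >> = chr x *~ c.
Proof. by rewrite /chr freeg_mulz intz. Qed.

Lemma additive_linext (V : zmodType) (F : vchar k -> V) g :
  (forall g h, F (g + h) = F g + F h) -> F g = linext (F \o @chr k) g.
Proof.
move=> FD; have F0 : F 0 = 0 by apply: (addrI (F 0)); rewrite -FD !addr0.
have FN h : F (- h) = - F h by apply: (addrI (F h)); rewrite -FD !subrr.
have FM h n : F (h *+ n) = F h *+ n by elim: n => [|n IH]; rewrite ?mulr0n // !mulrS FD IH.
have Fz h (c : int) : F (h *~ c) = F h *~ c by case: c => n; rewrite ?NegzE ?mulrNz ?FN FM.
rewrite -{1}(freeg_sumE g) (big_morph F FD F0); apply: eq_bigr => x _.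
by rewrite freegU_chr Fz.
Qed.

(** Virtual characters are generated by characters as an abelian group, so
    identities between additive maps are checked on characters only. *)
Lemma eq_additive (V : zmodType) (F G : vchar k -> V) g :
  (forall g h, F (g + h) = F g + F h) -> (forall g h, G (g + h) = G g + G h) ->
  (forall x, F (chr x) = G (chr x)) -> F g = G g.
Proof.
by move=> FD GD FG; rewrite (additive_linext _ FD) (additive_linext _ GD); apply: eq_linext.
Qed.

Lemma vbarE g : vbar g = linext (fun x => chr (- x)) g.
Proof. by apply: eq_bigr => x _; rewrite freegU_chr. Qed.

Lemma vmulE g h : vmul g h = linext (fun x => linext (fun y => chr (x + y)) h) g.
Proof.
apply: eq_bigr => x _; rewrite /linext mulrz_suml; apply: eq_bigr => y _.
by rewrite freegU_chr mulrC mulrzA.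
Qed.

Lemma vmulDl g1 g2 h : vmul (g1 + g2) h = vmul g1 h + vmul g2 h.
Proof. by rewrite !vmulE linextD. Qed.
Lemma vmulNl g h : vmul (- g) h = - vmul g h.
Proof. by rewrite !vmulE linextN. Qed.
Lemma vmul0l h : vmul 0 h = 0.
Proof. by rewrite !vmulE linext0. Qed.
Lemma vmulDr g h1 h2 : vmul g (h1 + h2) = vmul g h1 + vmul g h2.
Proof. by rewrite !vmulE -linext_split; apply: eq_linext => x; rewrite linextD. Qed.
Lemma vmulNr g h : vmul g (- h) = - vmul g h.
Proof. by rewrite !vmulE -linext_opp; apply: eq_linext => x; rewrite linextN. Qed.
Lemma vmul0r g : vmul g 0 = 0.
Proof. by rewrite vmulE /linext big1 // => x _; rewrite dom0 big_nil mul0rz. Qed.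
Lemma vmulU x y : vmul (chr x) (chr y) = chr (x + y) :> vchar k.
Proof. by rewrite vmulE !linextU. Qed.
Lemma vbarD g h : vbar (g + h) = vbar g + vbar h.
Proof. by rewrite !vbarE linextD. Qed.
Lemma vbar0 : vbar (0 : vchar k) = 0.
Proof. by rewrite vbarE linext0. Qed.
Lemma vbarU x : vbar (chr x : vchar k) = chr (- x).
Proof. by rewrite vbarE linextU. Qed.

Lemma vmul_suml I (s : seq I) (Q : pred I) (F : I -> vchar k) h :
  vmul (\sum_(i <- s | Q i) F i) h = \sum_(i <- s | Q i) vmul (F i) h.
Proof. exact: (big_morph (fun g => vmul g h) (fun g1 g2 => vmulDl g1 g2 h) (vmul0l h)). Qed.
Lemma vmul_sumr I (s : seq I) (Q : pred I) (F : I -> vchar k) g :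
  vmul g (\sum_(i <- s | Q i) F i) = \sum_(i <- s | Q i) vmul g (F i).
Proof. exact: (big_morph (vmul g) (vmulDr g) (vmul0r g)). Qed.
Lemma vbar_sum I (s : seq I) (Q : pred I) (F : I -> vchar k) :
  vbar (\sum_(i <- s | Q i) F i) = \sum_(i <- s | Q i) vbar (F i).
Proof. by apply: (big_morph _ vbarD vbar0). Qed.

Lemma coeff_vmul_chrl x z g : coeff x (vmul (chr z) g) = coeff (x - z) g.
Proof.
apply: (eq_additive (F := fun g => coeff x (vmul (chr z) g))) => [? ?|? ?|y].
- by rewrite vmulDr coeffD.
- by rewrite coeffD.
- by rewrite vmulU !coeffU !mul1r addrC -(inj_eq (addIr z) y) subrK.
Qed.

Lemma coeff_vmul_chrr x z g : coeff x (vmul g (chr z)) = coeff (x - z) g.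
Proof.
apply: (eq_additive (F := fun g => coeff x (vmul g (chr z)))) => [? ?|? ?|y].
- by rewrite vmulDl coeffD.
- by rewrite coeffD.
- by rewrite vmulU !coeffU !mul1r -(inj_eq (addIr z) y) subrK.
Qed.
End Additive.

Section MultiplicativeExtension.
Variables (k : nat) (U : comUnitRingType).
Implicit Types (w : 'rV[int]_k -> U) (g h : vchar k).

Definition mulext w g : U := \prod_(x <- dom g) w x ^ coeff x g.

Lemma mulext_widen w g (s : seq 'rV[int]_k) :
  uniq s -> {subset dom g <= s} -> mulext w g = \prod_(x <- s) w x ^ coeff x g.
Proof.
move=> us sub; rewrite [RHS](bigID (mem (dom g))) /= [X in _ * X]big1 ?mulr1; last first.
  by move=> x nx; rewrite coeff_outdom.
rewrite -[RHS]big_filter; apply: perm_big; apply: uniq_perm => [||x].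
- exact: uniq_dom.
- exact: filter_uniq.
- by rewrite mem_filter andb_idr // => /sub.
Qed.

(** Integer powers are only additive in the exponent for units; weights with
    vanishing Euler class need a separate argument. *)
Lemma mulextD w g h : (forall x, w x \is a GRing.unit) ->
  mulext w (g + h) = mulext w g * mulext w h.
Proof.
move=> wu; pose s := undup (dom g ++ dom h).
have us : uniq s := undup_uniq _.
rewrite !(@mulext_widen w _ s) // -?big_split /=; first 1 last.
- by move=> x xs; rewrite mem_undup mem_cat xs orbT.
- by move=> x xs; rewrite mem_undup mem_cat xs.
- by move=> x /domD_subset; rewrite mem_undup.
by apply: eq_bigr => x _; rewrite coeffD exprzDr.
Qed.

Lemma mulext0 w : mulext w 0 = 1.
Proof. by rewrite /mulext dom0 big_nil. Qed.

Lemma mulextU w x : mulext w (chr x) = w x.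
Proof. by rewrite /mulext /chr domU1 big_seq1 coeffU eqxx mulr1. Qed.

Lemma eq_mulext w1 w2 g : {in dom g, w1 =1 w2} -> mulext w1 g = mulext w2 g.
Proof.
move=> e; rewrite /mulext big_seq [RHS]big_seq; apply: eq_bigr => x xg.
by rewrite e.
Qed.

Lemma mulextZ w g (c : int) : (forall x, w x \is a GRing.unit) ->
  mulext w (g *~ c) = mulext w g ^ c.
Proof.
move=> wu; have unit h : mulext w h \is a GRing.unit.
  rewrite /mulext; apply: (big_ind (fun u => u \is a GRing.unit)) => [|u v uu uv|x _].
  - exact: unitr1.
  - by rewrite unitrM uu.
  - exact: unitrXz.
have M n : mulext w (g *+ n) = mulext w g ^+ n.
  by elim: n => [|n IH]; rewrite ?mulext0 // mulrS exprS mulextD ?IH.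
case: c => n; rewrite ?NegzE ?mulrNz ?M //.
apply: (mulrI (unit (g *+ n.+1))); rewrite -mulextD // subrr mulext0.
by rewrite -exprz_inv -exprnP exprVn -M mulrV.
Qed.
End MultiplicativeExtension.

Section Restriction.
Variables (k k' : nat) (P : 'M[int]_(k, k')).
Implicit Types (g h : vchar k).

Definition push g : vchar k' := linext (fun x => chr (x *m P)) g.

Lemma pushD g h : push (g + h) = push g + push h.
Proof. exact: linextD. Qed.
Lemma pushN g : push (- g) = - push g.
Proof. exact: linextN. Qed.
Lemma pushU x : push (chr x) = chr (x *m P).
Proof. exact: linextU. Qed.
Lemma push_sum I (s : seq I) (Q : pred I) (F : I -> vchar k) :
  push (\sum_(i <- s | Q i) F i) = \sum_(i <- s | Q i) push (F i).
Proof. exact: linext_sum. Qed.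

Lemma push_vmul g h : push (vmul g h) = vmul (push g) (push h).
Proof.
apply: (eq_additive (F := fun g => push (vmul g h)) (G := fun g => vmul (push g) (push h)))
  => [? ?|? ?|x]; rewrite ?vmulDl ?pushD ?vmulDl //.
apply: (eq_additive (F := fun h => push (vmul (chr x) h))
  (G := fun h => vmul (push (chr x)) (push h))) => [? ?|? ?|y].
- by rewrite vmulDr pushD.
- by rewrite pushD vmulDr.
- by rewrite !(vmulU, pushU) mulmxDl.
Qed.

Lemma push_vbar g : push (vbar g) = vbar (push g).
Proof.
apply: (eq_additive (F := fun g => push (vbar g)) (G := fun g => vbar (push g))) => [? ?|? ?|x].
- by rewrite vbarD pushD.
- by rewrite pushD vbarD.
- by rewrite !(vbarU, pushU) mulNmx.
Qed.

Lemma vdet_push g : vdet (push g) = vdet g *m P.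
Proof.
have dD k0 (a b : vchar k0) : vdet (a + b) = vdet a + vdet b := linextD id a b.
have dU k0 (x : 'rV[int]_k0) : vdet (chr x) = x := linextU id x.
apply: (eq_additive (F := fun g => vdet (push g)) (G := fun g => vdet g *m P)) => [? ?|? ?|x].
- by rewrite pushD dD.
- by rewrite dD mulmxDl.
- by rewrite pushU !dU.
Qed.

Lemma deg_push g : deg (push g) = deg g.
Proof.
apply: (eq_additive (F := fun g => deg (push g))) => [? ?|? ?|x].
- by rewrite pushD degD.
- exact: degD.
- by rewrite pushU !degU.
Qed.

Lemma coeff_push y g :
  coeff y (push g) = \sum_(x <- dom g | x *m P == y) coeff x g.
Proof.
rewrite /push /linext raddf_sum [RHS]big_mkcond /=; apply: eq_bigr => x _.
by rewrite raddfMz /= coeffU mul1r; case: eqP => _; rewrite ?mul0rz ?intz.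
Qed.

(** Characters that become equal after restriction are grouped together, which is
    legitimate because the values [w y] can be cancelled. *)
Lemma mulext_push (U : comUnitRingType) (w : 'rV[int]_k' -> U) g :
  (forall y, w y \is a GRing.unit) ->
  mulext w (push g) = mulext (fun x => w (x *m P)) g.
Proof.
move=> wu; rewrite /push /linext (big_morph (mulext w) (id1 := 1) (op1 := *%R)).
- by apply: eq_bigr => x _; rewrite mulextZ // mulextU.
- by move=> a b; rewrite mulextD.
- exact: mulext0.
Qed.
End Restriction.

Lemma push_id k (g : vchar k) : push 1%:M g = g.
Proof.
apply: (eq_additive (F := push 1%:M) (G := id)) => [? ?|//|x]; first exact: pushD.
by rewrite pushU mulmx1.
Qed.

Lemma push_comp k1 k2 k3 (P : 'M_(k1, k2)) (Q : 'M_(k2, k3)) g :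
  push Q (push P g) = push (P *m Q) g.
Proof.
apply: (eq_additive (F := fun g => push Q (push P g))) => [? ?|? ?|x].
- by rewrite !pushD.
- by rewrite pushD.
- by rewrite !pushU mulmxA.
Qed.

(** * Formal power series *)

Section ConstantSeries.
Variable R : comNzRingType.

Fact constS_is_zmod_morphism : zmod_morphism (@constS R).
Proof. by move=> a b; apply/fpsP => n /=; rewrite mulrnBl. Qed.
Fact constS_is_monoid_morphism : monoid_morphism (@constS R).
Proof.
split=> // a b; apply/fpsP => n; rewrite coefSM big_ord_recl big1 ?addr0 => [|i _].
  by rewrite subn0 /= mulrnAr.
by rewrite /= mul0r.
Qed.

HB.instance Definition _ :=
  GRing.isZmodMorphism.Build R (fps R) (@constS R) constS_is_zmod_morphism.
HB.instance Definition _ :=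
  GRing.isMonoidMorphism.Build R (fps R) (@constS R) constS_is_monoid_morphism.
End ConstantSeries.

Section MapSeries.
Variables (R R' : comNzRingType) (u : {rmorphism R -> R'}).

Fact mapS_is_zmod_morphism : zmod_morphism (mapS u).
Proof. by move=> f g; apply/fpsP => n /=; rewrite rmorphB. Qed.
Fact mapS_is_monoid_morphism : monoid_morphism (mapS u).
Proof.
split=> [|f g]; apply/fpsP => n; first by rewrite /= rmorphMn rmorph1.
by rewrite /= rmorph_sum; apply: eq_bigr => i _; rewrite rmorphM.
Qed.

HB.instance Definition _ :=
  GRing.isZmodMorphism.Build (fps R) (fps R') (mapS u) mapS_is_zmod_morphism.
HB.instance Definition _ :=
  GRing.isMonoidMorphism.Build (fps R) (fps R') (mapS u) mapS_is_monoid_morphism.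
End MapSeries.

Lemma mapS_logS (K K' : fieldType) (u : {rmorphism K -> K'}) (f : fps K) :
  mapS u (logS f) = logS (mapS u f).
Proof.
apply/fpsP => n /=; rewrite rmorph_sum; apply: eq_bigr => k _.
rewrite fmorph_div rmorphM rmorph_sign rmorph_nat; congr (_ * _ / _).
by rewrite -[u _]/(coefS (mapS u _) n) rmorphXn rmorphB rmorph1.
Qed.

Lemma coefSM0 (R : comNzRingType) (f g : fps R) : coefS (f * g) 0 = coefS f 0 * coefS g 0.
Proof. by rewrite coefSM big_ord1. Qed.

Section EulerOperator.
Variable R : comNzRingType.
Implicit Types f g : fps R.

(** The operator [q d/dq]. *)
Definition qderiv f : fps R := Fps (fun n => coefS f n *+ n).

Lemma qderivD f g : qderiv (f + g) = qderiv f + qderiv g.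
Proof. by apply/fpsP => n /=; rewrite mulrnDl. Qed.

Lemma qderivM f g : qderiv (f * g) = qderiv f * g + f * qderiv g.
Proof.
apply/fpsP => n; rewrite coefSD !coefSM /= -big_split -sumrMnl.
apply: eq_bigr => i _ /=.
by rewrite mulrnAl mulrnAr -mulrnDr subnKC // -ltnS.
Qed.

Lemma qderiv0 : qderiv 0 = 0.
Proof. by apply/fpsP => n; rewrite /= !mul0rn. Qed.

Lemma qderiv1 : qderiv 1 = 0.
Proof. by apply/fpsP => -[|n] //=; rewrite mulr0n mul0rn. Qed.

Lemma qderivX f k : qderiv (f ^+ k.+1) = (f ^+ k * qderiv f) *+ k.+1.
Proof.
elim: k => [|k IH]; first by rewrite expr1 mul1r.
by rewrite exprS qderivM IH mulrnAr mulrA -exprS mulrC -mulrS.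
Qed.
End EulerOperator.

Section Exponential.
Variable K : fieldType.
Hypothesis char0 : forall n, n.+1%:R != 0 :> K.
Implicit Types f g : fps K.

Lemma fact_neq0 n : n`!%:R != 0 :> K.
Proof. by case: n`! (fact_gt0 n). Qed.

(** Since [f] has no constant term, truncating the exponential further out does
    not change the coefficient. *)
Lemma coef_expS f n m : coefS f 0 = 0 -> (n < m)%N ->
  coefS (expS f) n = \sum_(k < m) coefS (f ^+ k) n / k`!%:R.
Proof.
move=> f0 nm; rewrite /= big_mkord.
rewrite (big_ord_widen m (fun k => coefS (f ^+ k) n / k`!%:R)) //.
rewrite [RHS](bigID (fun k : 'I_m => (k < n.+1)%N)) /= [X in _ + X]big1 ?addr0 // => k.
by rewrite -leqNgt => nk; rewrite coefSX_lt ?mul0r.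
Qed.

(** The product formula is only ever used through this differential equation: it
    determines the coefficients of an exponential recursively, without
    [exp (f + g) = exp f * exp g] or an inverse of [expS]. *)
Lemma qderiv_expS f : coefS f 0 = 0 -> qderiv (expS f) = expS f * qderiv f.
Proof.
move=> f0; apply/fpsP => n.
rewrite coefSM -[LHS]/(coefS (expS f) n *+ n) (coef_expS (m := n.+2)) //.
rewrite big_ord_recl expr0 coefS1 fact0 divr1 mulrnDl -(mulr_natr (n == 0)%:R n).
rewrite -natrM (_ : (n == 0) * n = 0)%N ?mul0r ?add0r; last by case: n.
have -> : \sum_(i < n.+1) coefS (expS f) i * coefS (qderiv f) (n - i) =
    \sum_(i < n.+1) \sum_(k < n.+1) coefS (f ^+ k) i / k`!%:R * coefS (qderiv f) (n - i).
  by apply: eq_bigr => i _; rewrite (coef_expS (m := n.+1)) // mulr_suml.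
rewrite exchange_big -sumrMnl; apply: eq_bigr => k _ /=.
have -> : \sum_(i < n.+1) coefS (f ^+ k) i / k`!%:R * coefS (qderiv f) (n - i)
     = coefS (f ^+ k * qderiv f) n / k`!%:R.
  by rewrite coefSM mulr_suml; apply: eq_bigr => i _; rewrite mulrAC.
rewrite -mulrnAl -[_ *+ n]/(coefS (qderiv (f ^+ k.+1)) n) qderivX.
have coefMn (h : fps K) m : coefS (h *+ m) n = coefS h n *+ m.
  by elim: m => [|m IH]; rewrite ?mulr0n ?coefS0 // !mulrS coefSD IH.
rewrite coefMn factS natrM invfM -[_ *+ _ in LHS]mulr_natr -!mulrA mulVKf //.
Qed.

Lemma expS_ode_prod I (s : seq I) (g : I -> fps K) : (forall i, coefS (g i) 0 = 0) ->
  qderiv (\prod_(i <- s) expS (g i)) =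
    \prod_(i <- s) expS (g i) * qderiv (\sum_(i <- s) g i).
Proof.
move=> g0; elim: s => [|i s IH]; first by rewrite !big_nil qderiv1 qderiv0 mulr0.
rewrite !big_cons qderivM IH qderiv_expS // qderivD; ring.
Qed.

Lemma coef0_expS f : coefS (expS f) 0 = 1.
Proof. by rewrite /= big_nat1 fact0 divr1. Qed.

Lemma coef0_prod_expS I (s : seq I) (g : I -> fps K) :
  coefS (\prod_(i <- s) expS (g i)) 0 = 1.
Proof.
by elim: s => [|i s IH]; rewrite ?big_nil ?big_cons // coefSM0 IH coef0_expS mulr1.
Qed.

Lemma coef0_logS f : coefS (logS f) 0 = 0.
Proof. by rewrite /= big_geq. Qed.
End Exponential.

Section Monomials.
Variable K : fieldType.

Lemma coef_monSM (c : K) d (f : fps K) n :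
  coefS (monS c d * f) n = if (n < d)%N then 0 else c * coefS f (n - d).
Proof.
rewrite coefSM; case: ltnP => dn.
  rewrite big1 // => i _ /=; rewrite (_ : (i == d :> nat) = false) ?mul0r //.
  by apply/eqP => id; move: (ltn_ord i); rewrite id ltnS leqNgt dn.
rewrite (bigD1 (inord d)) //= inordK ?ltnS // eqxx mulr1n big1 ?addr0 // => i.
by rewrite -val_eqE /= inordK ?ltnS // => /negbTE->; rewrite mul0r.
Qed.

Lemma monSM (c c' : K) d d' : monS c d * monS c' d' = monS (c * c') (d + d').
Proof.
apply/fpsP => n; rewrite coef_monSM /=; case: ltnP => dn.
  rewrite (_ : (n == (d + d')%N) = false) //; apply/eqP => nE.
  by rewrite nE ltnNge leq_addr in dn.
by rewrite -(eqn_add2l d) subnKC // mulrnAr.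
Qed.

Lemma monS1_0 : monS (1 : K) 0 = 1.
Proof. by []. Qed.

Lemma monS_eq0 (c : K) d : (monS c d == 0) = (c == 0).
Proof.
apply/eqP/eqP => [/fpsP/(_ d) /=|->]; first by rewrite eqxx mulr1n mul0rn.
by apply/fpsP => n /=; rewrite !mul0rn.
Qed.

(** Dividing by [monS c 1] costs exactly one power of the variable. *)
Lemma monS_shift (c : K) d (f : fps K) : c != 0 ->
  monS 1 d.+1 * f = monS 1 d * (monS c^-1 0 * f) * monS c 1.
Proof.
by move=> c0; rewrite mulrAC mulrA !monSM mul1r mulfV // addn0 addn1.
Qed.

Lemma fps_factor d (f : fps K) : (forall n, (n < d)%N -> coefS f n = 0) ->
  exists g, f = monS 1 d * g.
Proof.
move=> low; exists (Fps (fun n => coefS f (d + n))); apply/fpsP => n.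
by rewrite coef_monSM /= mul1r; case: ltnP => [/low //|dn]; rewrite subnKC.
Qed.
End Monomials.

(** * Restriction as a relation *)

Section Specialization.
Variables (A A' : idomainType) (phi : {rmorphism A -> A'}).
Local Notation K := {fraction A}.
Local Notation K' := {fraction A'}.

(** The graph of [phi] extended to the localization of [A] at the prime [ker phi]:
    fractions whose denominator survives under [phi]. *)
Definition specK (z : K) (z' : K') : Prop :=
  exists a b, [/\ phi b != 0, z = a%:F / b%:F & z' = (phi a)%:F / (phi b)%:F].

Lemma phi_neq0 b : phi b != 0 -> b != 0.
Proof. by apply: contra_neq => ->; rewrite rmorph0. Qed.

Lemma specK_phi a : specK a%:F (phi a)%:F.
Proof. by exists a, 1; rewrite !rmorph1 oner_neq0 !divr1. Qed.

(** The relation is single-valued; by additivity it is enough to know this at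
    [0]. *)
Lemma specK0_eq0 z' : specK 0 z' -> z' = 0.
Proof.
case=> a [b [b0 /esym/eqP + ->]].
rewrite mulf_eq0 invr_eq0 !tofrac_eq0 (negbTE (phi_neq0 b0)) orbF => /eqP->.
by rewrite !rmorph0 mul0r.
Qed.

Lemma specKD x x' y y' : specK x x' -> specK y y' -> specK (x + y) (x' + y').
Proof.
move=> [a [b [b0 -> ->]]] [c [d [d0 -> ->]]].
exists (a * d + c * b), (b * d); have b1 := phi_neq0 b0; have d1 := phi_neq0 d0.
rewrite !(rmorphD, rmorphM) mulf_neq0 //.
by split=> //; rewrite addf_div ?tofrac_eq0.
Qed.

Lemma specKM x x' y y' : specK x x' -> specK y y' -> specK (x * y) (x' * y').
Proof.
move=> [a [b [b0 -> ->]]] [c [d [d0 -> ->]]].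
exists (a * c), (b * d); rewrite !rmorphM mulf_neq0 //.
by split=> //; rewrite mulf_div.
Qed.

Lemma specKN x x' : specK x x' -> specK (- x) (- x').
Proof.
by case=> [a [b [b0 -> ->]]]; exists (- a), b; rewrite !rmorphN !mulNr.
Qed.

Lemma specKV x x' : x' != 0 -> specK x x' -> specK x^-1 x'^-1.
Proof.
move=> + [a [b [b0 xE x'E]]]; rewrite xE x'E => x0; exists b, a; split=> //; rewrite ?invf_div //.
by apply: contraNneq x0 => ->; rewrite rmorph0 mul0r.
Qed.

Lemma specK0 : specK 0 0.
Proof. by have := specK_phi 0; rewrite !rmorph0. Qed.

Lemma specK1 : specK 1 1.
Proof. by have := specK_phi 1; rewrite !rmorph1. Qed.

Lemma specK_nat n : specK n%:R n%:R.
Proof. by have := specK_phi n%:R; rewrite !rmorph_nat. Qed.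

Lemma specKX x x' n : specK x x' -> specK (x ^+ n) (x' ^+ n).
Proof.
move=> xx'; elim: n => [|n IH]; first exact: specK1.
by rewrite !exprS; apply: specKM.
Qed.

Lemma specK_sum I (s : seq I) (F : I -> K) (F' : I -> K') :
  (forall i, specK (F i) (F' i)) -> specK (\sum_(i <- s) F i) (\sum_(i <- s) F' i).
Proof.
move=> FF; apply: (big_ind2 specK) => // [|x x' y y'].
- exact: specK0.
- exact: specKD.
Qed.

Definition specS (f : fps K) (f' : fps K') : Prop :=
  forall n, specK (coefS f n) (coefS f' n).

Lemma specS_const c c' d : specK c c' -> specS (monS c d) (monS c' d).
Proof. by move=> cc n /=; case: eqP => _; rewrite ?mulr1n ?mulr0n //; apply: specK0. Qed.

Lemma specS0 : specS 0 0.
Proof. by move=> n; rewrite !coefS0; apply: specK0. Qed.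

Lemma specS1 : specS 1 1.
Proof. exact: (specS_const 0 specK1). Qed.

Lemma specSD f f' g g' : specS f f' -> specS g g' -> specS (f + g) (f' + g').
Proof. by move=> ff gg n; rewrite !coefSD; apply: specKD. Qed.

Lemma specSN f f' : specS f f' -> specS (- f) (- f').
Proof. by move=> ff n; rewrite !coefSN; apply: specKN. Qed.

Lemma specSM f f' g g' : specS f f' -> specS g g' -> specS (f * g) (f' * g').
Proof. by move=> ff gg n; rewrite !coefSM; apply: specK_sum => i; apply: specKM. Qed.

Lemma specSX f f' n : specS f f' -> specS (f ^+ n) (f' ^+ n).
Proof.
move=> ff; elim: n => [|n IH]; first exact: specS1.
by rewrite !exprS; apply: specSM.
Qed.

Lemma coef0_spec_unit f f' : specS f f' -> coefS f' 0 != 0 ->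
  (f \is a GRing.unit) && (f' \is a GRing.unit).
Proof.
move=> ff f0; rewrite !unitSE !unitfE f0 andbT; apply: contraNneq f0 => f0.
by apply/eqP/specK0_eq0; rewrite -f0.
Qed.

(** The coefficients of an inverse are given by a recursion whose only division is
    by the constant term. *)
Lemma specSV f f' : specS f f' -> coefS f' 0 != 0 -> specS f^-1 f'^-1.
Proof.
move=> ff f'0; have /andP[uf uf'] := coef0_spec_unit ff f'0.
have rec (F : fieldType) (h : fps F) (n : nat) : h \is a GRing.unit ->
    coefS h^-1 n = (coefS h 0)^-1 * ((n == 0)%N%:R - \sum_(i < n) coefS h i.+1 * coefS h^-1 (n - i.+1)).
  move=> uh; have h0 : coefS h 0 != 0 by rewrite unitSE unitfE in uh.
  have /fpsP/(_ n) := divrr uh; rewrite coefS1 coefSM big_ord_recl subn0 => <-.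
  by rewrite /bump /= addrK mulKf.
move=> n; elim/ltn_ind: n => n IH; rewrite !rec //.
apply: specKM; first exact: specKV.
apply: specKD; first exact: specK_nat.
apply/specKN/specK_sum => i; apply: specKM; first exact: ff.
by apply: IH; rewrite ltn_subLR // addSn ltnS leq_addl.
Qed.

Lemma specS_exp f f' : (forall n, n.+1%:R != 0 :> K') -> specS f f' -> specS (expS f) (expS f').
Proof.
move=> char0 ff n /=; apply: specK_sum => k; apply: specKM; first exact: specSX.
by apply: specKV; [exact: fact_neq0 | exact: specK_nat].
Qed.

(** The specialization of Laurent series in [b]: poles in [b] are allowed,
    coefficients must be regular. *)
Definition specL (x : {fraction (fps K)}) (x' : {fraction (fps K')}) : Prop :=
  exists m f f', [/\ specS f f', x = f%:F / (monS 1 m)%:F & x' = f'%:F / (monS 1 m)%:F].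

Lemma specL_fps f f' : specS f f' -> specL f%:F f'%:F.
Proof. by move=> ff; exists 0%N, f, f'; rewrite !monS1_0 !rmorph1 !divr1. Qed.

Lemma specL0 : specL 0 0.
Proof. by rewrite -!tofrac0; apply: specL_fps specS0. Qed.

Lemma specL1 : specL 1 1.
Proof. by rewrite -!tofrac1; apply: specL_fps specS1. Qed.

Lemma specL_nat n : specL n%:R n%:R.
Proof.
rewrite -!(rmorph_nat (@tofrac _)); apply: specL_fps => i.
rewrite -!(rmorph_nat (@constS _)); apply: (specS_const 0); exact: specK_nat.
Qed.

Lemma monS_neq0 (F : fieldType) m : (monS (1 : F) m)%:F != 0.
Proof. by rewrite tofrac_eq0 monS_eq0 oner_eq0. Qed.

Lemma specLD x x' y y' : specL x x' -> specL y y' -> specL (x + y) (x' + y').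
Proof.
move=> [m [f [f' [ff -> ->]]]] [n [g [g' [gg -> ->]]]].
exists (m + n)%N, (f * monS 1 n + g * monS 1 m), (f' * monS 1 n + g' * monS 1 m).
split.
- by apply: specSD; apply: specSM => //; apply: specS_const specK1.
- by rewrite addf_div ?monS_neq0 // -!rmorphM -rmorphD monSM mulr1.
- by rewrite addf_div ?monS_neq0 // -!rmorphM -rmorphD monSM mulr1.
Qed.

Lemma specLM x x' y y' : specL x x' -> specL y y' -> specL (x * y) (x' * y').
Proof.
move=> [m [f [f' [ff -> ->]]]] [n [g [g' [gg -> ->]]]].
exists (m + n)%N, (f * g), (f' * g').
split; first exact: specSM.
- by rewrite mulf_div -!rmorphM monSM mulr1.
- by rewrite mulf_div -!rmorphM monSM mulr1.
Qed.

Lemma specLN x x' : specL x x' -> specL (- x) (- x').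
Proof.
move=> [m [f [f' [ff -> ->]]]]; exists m, (- f), (- f').
by rewrite !rmorphN !mulNr; split=> //; apply: specSN.
Qed.

Lemma specLX x x' n : specL x x' -> specL (x ^+ n) (x' ^+ n).
Proof.
move=> xx'; elim: n => [|n IH]; first exact: specL1.
by rewrite !exprS; apply: specLM.
Qed.

Lemma specL_sum I (s : seq I) (Q : pred I) F F' :
  (forall i, Q i -> specL (F i) (F' i)) ->
  specL (\sum_(i <- s | Q i) F i) (\sum_(i <- s | Q i) F' i).
Proof.
move=> FF; apply: (big_ind2 specL) => // [|x x' y y'].
- exact: specL0.
- exact: specLD.
Qed.

Lemma specL_prod I (s : seq I) (Q : pred I) F F' :
  (forall i, Q i -> specL (F i) (F' i)) ->
  specL (\prod_(i <- s | Q i) F i) (\prod_(i <- s | Q i) F' i).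
Proof.
move=> FF; apply: (big_ind2 specL) => // [|x x' y y'].
- exact: specL1.
- exact: specLM.
Qed.

(** Relating the degreewise topologies of both sides: vanishing to order [d] in
    [b] is inherited by the restriction, because [0] restricts only to [0]. *)
Lemma specL_small d (g : fps K) x' : specL (monS 1 d * g)%:F x' ->
  exists g' : fps K', x' = (monS 1 d * g')%:F.
Proof.
move=> [m [f [f' [ff fE ->]]]].
have fE' : f = monS 1 (m + d) * g.
  apply/eqP; rewrite -tofrac_eq -(mulfVK (monS_neq0 _ m) f%:F) -fE -rmorphM.
  by rewrite mulrC mulrA monSM mulr1.
have [g' ->] : exists g', f' = monS 1 (m + d) * g'.
  apply: fps_factor => n nd; apply: specK0_eq0; have := ff n.
  by rewrite fE' coef_monSM nd.
exists g'; rewrite -{1}(mulr1 1) -monSM -mulrA (mulrC (monS 1 m)) rmorphM mulfK //.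
exact: monS_neq0.
Qed.

(** Specialization of invertible elements: [specL x x'] alone would allow
    [x^-1] to have a pole along the kernel of [phi].  As [0^-1 = 0], the
    condition is stable under products and integer powers without any
    nonvanishing hypothesis. *)
Definition specU x x' := specL x x' /\ specL x^-1 x'^-1.

Lemma specUM x x' y y' : specU x x' -> specU y y' -> specU (x * y) (x' * y').
Proof. by move=> [x1 x2] [y1 y2]; split; rewrite ?invfM; apply: specLM. Qed.

Lemma specUV x x' : specU x x' -> specU x^-1 x'^-1.
Proof. by case=> x1 x2; split; rewrite ?invrK. Qed.

Lemma specUXz x x' (n : int) : specU x x' -> specU (x ^ n) (x' ^ n).
Proof.
have nat y y' m : specU y y' -> specU (y ^+ m) (y' ^+ m).
  by case=> y1 y2; split; rewrite -?exprVn; apply: specLX.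
case: n => n xx; first exact: nat.
by rewrite NegzE -!exprz_inv; apply/nat/specUV.
Qed.

Lemma specU_prod I (s : seq I) (Q : pred I) F F' :
  (forall i, Q i -> specU (F i) (F' i)) ->
  specU (\prod_(i <- s | Q i) F i) (\prod_(i <- s | Q i) F' i).
Proof.
by move=> FF; split; rewrite -?prodfV; apply: specL_prod => i /FF[].
Qed.

Lemma tofracV_unit (F : fieldType) (f : fps F) : f \is a GRing.unit -> (f%:F)^-1 = (f^-1)%:F.
Proof. by move=> uf; rewrite rmorphV. Qed.

Lemma specU_unit f f' : specS f f' -> coefS f' 0 != 0 -> specU f%:F f'%:F.
Proof.
move=> ff f0; have /andP[uf uf'] := coef0_spec_unit ff f0.
by split; rewrite ?tofracV_unit //; apply: specL_fps => //; apply: specSV.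
Qed.

Lemma specU_mon m : specU (monS 1 m)%:F (monS 1 m)%:F.
Proof.
split; first by apply/specL_fps/specS_const/specK1.
by exists m, 1, 1; rewrite !tofrac1 !div1r; split=> //; apply: specS1.
Qed.
End Specialization.

(** * Restriction of characteristic classes *)

Section ExponentialOfMonomial.
Variable K : fieldType.

Lemma monSX (c : K) n : monS c 1 ^+ n = monS (c ^+ n) n.
Proof.
elim: n => [|n IH]; first by rewrite !expr0 monS1_0.
by rewrite exprS IH monSM -exprS add1n.
Qed.

Lemma coef_exp_mon (c : K) n : coefS (expS (monS c 1)) n = c ^+ n / n`!%:R.
Proof.
rewrite /= big_mkord (bigD1 ord_max) //= big1 => [|i /negbTE ni].
  by rewrite addr0 monSX /= eqxx mulr1n.
rewrite monSX /= (_ : (n == i :> nat) = false) ?mul0r //.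
by apply: contraFF ni => /eqP ni; apply/eqP/val_inj.
Qed.

(** The power series [(1 - exp (- c b)) / b]. *)
Definition todd_den (c : K) : fps K := Fps (fun n => - (- c) ^+ n.+1 / n.+1`!%:R).

(** A K-theoretic factor [1 - exp (- c b)] has the same leading term as the
    cohomological factor [c b]; this puts the Segre, Chern and Verlinde cases on
    the same footing. *)
Lemma one_sub_exp (c : K) : 1 - expS (monS (- c) 1) = monS 1 1 * todd_den c.
Proof.
apply/fpsP => -[|n]; rewrite coefSD coefSN coef_exp_mon coef_monSM.
  by rewrite fact0 divr1 expr0 coefS1 subrr.
by rewrite coefS1 /= add0r mul1r subn1 mulNr.
Qed.
End ExponentialOfMonomial.

Section ChernRoots.
Variables (R : realType) (k : nat).
Local Notation A := {mpoly R[i][k]}.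
Implicit Types x y : 'rV[int]_k.

Definition c1p (x : 'rV[int]_k) : A := \sum_(i < k) 'X_i *~ x 0 i.

Lemma c1E x : c1 R x = (c1p x)%:F.
Proof. by rewrite /c1 /c1p rmorph_sum; apply: eq_bigr => i _; rewrite rmorphMz. Qed.

Lemma c1pD x y : c1p (x + y) = c1p x + c1p y.
Proof. by rewrite /c1p -big_split; apply: eq_bigr => i _; rewrite mxE mulrzDr. Qed.

Lemma c1p_eq0 x : (c1p x == 0) = (x == 0).
Proof.
apply/eqP/eqP => [c0|->]; last by rewrite /c1p big1 // => i _; rewrite mxE.
apply/rowP => i; rewrite mxE; have := congr1 (mcoeff U_(i)%MM) c0.
rewrite /c1p mcoeff0 raddf_sum (bigD1 i) //= big1 => [|j ji].
  rewrite raddfMz /= mcoeffXU eqxx addr0 => /eqP.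
  by rewrite intr_eq0 => /eqP.
by rewrite raddfMz /= mcoeffXU (negbTE ji) mul0rz.
Qed.

Lemma c1_eq0 x : (c1 R x == 0) = (x == 0).
Proof. by rewrite c1E tofrac_eq0 c1p_eq0. Qed.

Lemma c1D x y : c1 R (x + y) = c1 R x + c1 R y.
Proof. by rewrite !c1E c1pD rmorphD. Qed.

Lemma c1N x : c1 R (- x) = - c1 R x.
Proof. by apply: (addrI (c1 R x)); rewrite -c1D !subrr; apply/eqP; rewrite c1_eq0. Qed.

Lemma c1Mz x (a : int) : c1 R (x *~ a) = c1 R x *~ a.
Proof.
have nat n : c1 R (x *+ n) = c1 R x *+ n.
  elim: n => [|n IH]; last by rewrite !mulrS c1D IH.
  by apply/eqP; rewrite mulr0n c1_eq0.
by case: a => n; rewrite ?NegzE ?mulrNz ?c1N nat.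
Qed.

(** [cst] written as a composite, from which it inherits its morphism laws. *)
Definition cst_comp : {rmorphism R[i] -> laurent R k} :=
  @tofrac (fps (ratfun R k)) \o (@constS (ratfun R k) \o (@tofrac A \o @mpolyC k R[i])).

Fact cst_is_zmod_morphism : zmod_morphism (@cst R k).
Proof. exact: (rmorphB cst_comp). Qed.
Fact cst_is_monoid_morphism : monoid_morphism (@cst R k).
Proof. by split; [exact: (rmorph1 cst_comp) | exact: (rmorphM cst_comp)]. Qed.
HB.instance Definition _ :=
  GRing.isZmodMorphism.Build R[i] (laurent R k) (@cst R k) cst_is_zmod_morphism.
HB.instance Definition _ :=
  GRing.isMonoidMorphism.Build R[i] (laurent R k) (@cst R k) cst_is_monoid_morphism.

Lemma laurent_char0 n : n.+1%:R != 0 :> laurent R k.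
Proof. by rewrite -(rmorph_nat (@cst R k)) fmorph_eq0 pnatr_eq0. Qed.

Lemma ratfun_char0 n : n.+1%:R != 0 :> ratfun R k.
Proof.
have -> : n.+1%:R = ((n.+1%:R : R[i])%:MP_[k])%:F :> ratfun R k.
  by rewrite mpolyC_nat rmorph_nat.
by rewrite tofrac_eq0 mpolyC_eq0 pnatr_eq0.
Qed.

Lemma ctot_unit x : 1 + c1b R x \is a @GRing.unit (fps (ratfun R k)).
Proof. by rewrite unitSE coefSD coefS1 /= mulr0n addr0 unitr1. Qed.
End ChernRoots.

Section RestrictionOfClasses.
Variables (R : realType) (k k' : nat) (P : 'M[int]_(k, k')).
Local Notation A := {mpoly R[i][k]}.
Local Notation A' := {mpoly R[i][k']}.
Implicit Types (x y : 'rV[int]_k) (g : vchar k).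

(** The pullback of functions along the subtorus dual to [P]: each coordinate
    is sent to the first Chern class of its restriction. *)
Definition restr : {rmorphism A -> A'} :=
  comp_mpoly [tuple \sum_(j < k') 'X_j *~ P i j | i < k].

Lemma restr_c1p x : restr (c1p R x) = c1p R (x *m P).
Proof.
rewrite /c1p rmorph_sum /=.
under eq_bigr => i _ do rewrite rmorphMz /= comp_mpolyXU -tnth_nth tnth_mktuple mulrz_suml.
rewrite exchange_big; apply: eq_bigr => j _; rewrite mxE mulrz_sumr.
by apply: eq_bigr => i _; rewrite -mulrzA mulrC.
Qed.

Local Notation specK := (specK restr).
Local Notation specS := (specS restr).
Local Notation specL := (specL restr).
Local Notation specU := (specU restr).

Lemma specK_c1 x : specK (c1 R x) (c1 R (x *m P)).
Proof. by rewrite !c1E -restr_c1p; apply: specK_phi. Qed.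

Lemma specS_c1b x : specS (c1b R x) (c1b R (x *m P)).
Proof. exact/specS_const/specK_c1. Qed.

Lemma specL_cst z : specL (cst k z) (cst k' z).
Proof.
apply/specL_fps/(specS_const 0).
by have := specK_phi restr z%:MP_[k]; rewrite /= comp_mpolyC.
Qed.

Lemma specU_c1b x : x *m P != 0 -> specU (c1b R x)%:F (c1b R (x *m P))%:F.
Proof.
have cE k0 (y : 'rV[int]_k0) : c1b R y = monS (c1 R y) 0 * monS 1 1 by rewrite monSM mulr1.
move=> xP; rewrite !cE !rmorphM; apply: specUM; last exact: specU_mon.
by apply: specU_unit; [exact/specS_const/specK_c1 | rewrite /= mulr1n c1_eq0].
Qed.

Lemma specL_ch_char x : specL (ch_char R x) (ch_char R (x *m P)).
Proof. by apply/specL_fps/specS_exp/specS_c1b; apply: ratfun_char0. Qed.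

Lemma specS_todd_den c c' : specK c c' -> specS (todd_den c) (todd_den c').
Proof.
move=> cc n /=; apply: specKM; first by apply/specKN/specKX/specKN.
by apply: specKV; [exact/fact_neq0/ratfun_char0 | exact: specK_nat].
Qed.

Lemma ch_LambdaE k0 (x : 'rV[int]_k0) :
  1 - ch_char R (- x) = (monS 1 1)%:F * (todd_den (c1 R x))%:F.
Proof. by rewrite /ch_char /c1b c1N -rmorphM -one_sub_exp rmorphB rmorph1. Qed.

Lemma specU_ch_Lambda x : x *m P != 0 ->
  specU (1 - ch_char R (- x)) (1 - ch_char R (- (x *m P))).
Proof.
move=> xP; rewrite !ch_LambdaE; apply: specUM; first exact: specU_mon.
apply: specU_unit; first exact/specS_todd_den/specK_c1.
by rewrite /= expr1 opprK divr1 c1_eq0.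
Qed.

(** Both facts are carried through the product at once: a constant term [1] is
    what makes the inverse factors restrict. *)
Lemma specS_ctot g : specS (ctot R g) (ctot R (push P g)) /\ coefS (ctot R (push P g)) 0 = 1.
Proof.
pose Q f f' := specS f f' /\ coefS f' 0 = 1.
have QV f f' : Q f f' -> Q f^-1 f'^-1.
  move=> [ff f0]; split; first by apply: specSV; rewrite ?f0 ?oner_neq0.
  have /andP[_ uf] : _ && _ := coef0_spec_unit ff ltac:(by rewrite f0 oner_neq0).
  have /fpsP/(_ 0%N) := divrr uf.
  by rewrite coefSM0 f0 mul1r coefS1.
have QX f f' n : Q f f' -> Q (f ^+ n) (f' ^+ n).
  move=> [ff f0]; split; first exact: specSX.
  by elim: n => [|n IH]; rewrite ?coefS1 // exprS coefSM0 f0 IH mul1r.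
rewrite -[ctot R (push P g)]/(mulext _ _) mulext_push; last exact: ctot_unit.
apply: (big_ind2 Q) => [|f f' h h' [ff f0] [hh h0]|x _].
- by split; [exact: specS1 | rewrite coefS1].
- by split; [exact: specSM | rewrite coefSM0 f0 h0 mul1r].
have Qx : Q (1 + c1b R x) (1 + c1b R (x *m P)).
  split; last by rewrite coefSD coefS1 /= mulr0n addr0.
  by apply: specSD; [exact: specS1 | exact: specS_c1b].
by case: (coeff x g) => n; [exact: QX | rewrite NegzE -!exprz_inv; exact/QX/QV].
Qed.

Lemma specU_chern g : specU (chern R g) (chern R (push P g)).
Proof. by have [gg g0] := specS_ctot g; apply: specU_unit; rewrite // g0 oner_neq0. Qed.

Lemma specL_chern_class i g : specL (chern_class R i g) (chern_class R i (push P g)).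
Proof. by apply/specL_fps/specS_const; case: (specS_ctot g) => + _; apply. Qed.

Lemma specL_chern_part mu g : specL (chern_part R mu g) (chern_part R mu (push P g)).
Proof. by apply: specL_prod => i _; apply: specL_chern_class. Qed.

Lemma specL_ch_det g : specL (ch_det R g) (ch_det R (push P g)).
Proof. by rewrite /ch_det vdet_push; apply: specL_ch_char. Qed.

End RestrictionOfClasses.

Section KernelOfRestriction.
Variables (R : realType) (k k' : nat) (P : 'M[int]_(k, k')).
Implicit Types (x : 'rV[int]_k) (y : 'rV[int]_k') (g : vchar k).
Local Notation specL := (specL (restr R P)).
Local Notation specU := (specU (restr R P)).
Variable delta : 'rV[int]_k.
Hypothesis delta0 : delta != 0.
Hypothesis deltaP : delta *m P = 0.

Local Notation e := (c1b R delta)%:F.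

Lemma e_neq0 : e != 0.
Proof. by rewrite tofrac_eq0 monS_eq0 c1_eq0. Qed.

Lemma specK_c1_ker : specK (restr R P) (c1 R delta) 0.
Proof. by have := specK_c1 R P delta; rewrite deltaP (eqP (_ : c1 R 0 == 0)) // c1_eq0. Qed.

Lemma specL_e : specL e 0.
Proof.
have -> : 0 = (monS (0 : ratfun R k') 1)%:F.
  by apply/esym/eqP; rewrite tofrac_eq0 monS_eq0.
exact/specL_fps/specS_const/specK_c1_ker.
Qed.

Section Denominator.
Variables (w h : 'rV[int]_k -> laurent R k).
Variables (w' : 'rV[int]_k' -> laurent R k') (h' : 'rV[int]_k -> laurent R k').
Hypothesis w_reg : forall x, x *m P != 0 -> specU (w x) (w' (x *m P)).
Hypothesis w'_neq0 : forall y : 'rV[int]_k', y != 0 -> w' y != 0.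
Hypothesis w_ker : forall x, x *m P = 0 -> w x = e * h x.
Hypothesis h_reg : forall x, x *m P = 0 -> specL (h x) (h' x).
Hypothesis h'_delta : h' delta = 1.

Variable T : vchar k.
Hypothesis T_ker : forall x, x *m P = 0 -> coeff x T <= 0.
Hypothesis T_delta : coeff delta T < 0.

(** The passage from [T^vir] to [T^red].  Weights that stay nontrivial on the
    subtorus restrict without trouble.  Those that become trivial all sit in the
    denominator of [mulext w T] and contribute [e ^+ m] up to regular factors,
    where [- m] is their total multiplicity; here [m >= 1] because of [delta].
    Dividing by [e] leaves [e ^+ m.-1], which restricts to [0] unless [m = 1],
    that is, unless [T + chr 0] restricts to a class without trivial weight; in
    that case [delta] is the only weight concerned and its regular factor
    restricts to [1]. *)
Lemma specL_inv_mulext :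
  specL ((mulext w T)^-1 / e)
    (if coeff 0 (push P T + chr 0) < 0 then 0 else (mulext w' (push P T + chr 0))^-1).
Proof.
pose d x := `|coeff x T|%N.
have dE x : x *m P = 0 -> coeff x T = - (d x)%:Z by move=> /T_ker cx; rewrite /d lez0_abs ?opprK.
pose ker x := x *m P == 0.
pose m := (\sum_(x <- dom T | ker x) d x)%N.
have coef0 : coeff 0 (push P T + chr 0) = 1 - m%:Z.
  rewrite coeffD coeffU eqxx mulr1 addrC coeff_push /m (big_morph Posz PoszD (erefl _)) -sumrN.
  by congr (_ + _); apply: eq_bigr => x /eqP /dE.
have delta_dom : delta \in dom T by rewrite mem_dom lt_eqF.
have mD : m = (d delta + \sum_(x <- dom T | (x != delta) && ker x) d x)%N.
  by rewrite /m big_mkcond (bigD1_seq delta) ?uniq_dom //= -big_mkcondr {1}/ker deltaP eqxx.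
have m_gt0 : (0 < m)%N.
  by rewrite mD (leq_trans _ (leq_addr _ _)) // /d absz_gt0 lt_eqF.
(* [Pn] collects the weights that stay nontrivial, [H] the regular factors of
   the others. *)
pose Pn := \prod_(x <- dom T | ~~ ker x) w x ^ coeff x T.
pose Pn' := \prod_(x <- dom T | ~~ ker x) w' (x *m P) ^ coeff x T.
pose H := \prod_(x <- dom T | ker x) h x ^+ d x.
pose H' := \prod_(x <- dom T | ker x) h' x ^+ d x.
have PnP : specU Pn Pn' by apply: specU_prod => x /w_reg xr; apply: specUXz.
have HP : specL H H'.
  by apply: specL_prod => x /eqP /h_reg xr; apply: specLX.
have wE : mulext w T = Pn * (e ^+ m * H)^-1.
  rewrite /mulext (bigID ker) /= mulrC; congr (_ * _).
  rewrite /H /m -prodrXr -big_split -prodfV; apply: eq_bigr => x.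
  by move=> /eqP xP; rewrite dE // -exprz_inv -exprnP exprVn w_ker // exprMn.
have -> : (mulext w T)^-1 / e = Pn^-1 * (e ^+ m.-1 * H).
  rewrite wE invfM invrK -{1}(prednK m_gt0) exprS -!mulrA; congr (_ * _).
  by rewrite [e * _]mulrC -!mulrA mulVf ?mulr1 // e_neq0.
rewrite coef0 subr_lt0 (ltz_nat 1 m); case: ltnP => [m_gt1|m_le1].
  rewrite -(mulr0 Pn'^-1) -(mul0r H'); apply: specLM; first by case: PnP.
  apply: specLM => //; have [q ->] : exists q, m.-1 = q.+1.
    by case: (m) m_gt1 => [|[|q]] // _; exists q.
  rewrite exprS -(mul0r (0 ^+ q)).
  by apply: specLM; [exact: specL_e | exact/specLX/specL_e].
have m1 : m = 1%N by apply/eqP; rewrite eqn_leq m_le1.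
have d1 : d delta = 1%N /\ (\sum_(x <- dom T | (x != delta) && ker x) d x)%N = 0%N.
  have : (0 < d delta)%N by rewrite /d absz_gt0 lt_eqF.
  by move: mD; rewrite m1; case: (d delta) => [|[|?]] // [].
have H'1 : H' = 1.
  rewrite /H' big_mkcond (bigD1_seq delta) ?uniq_dom //= -big_mkcondr {1}/ker deltaP eqxx /=.
  rewrite (proj1 d1) expr1 h'_delta mul1r big_seq_cond big1 // => x /and3P[xT].
  move=> xd xP; have := proj2 d1; move/eqP; rewrite sum_nat_seq_eq0 => /allP/(_ x xT).
  by rewrite xd xP => /eqP->.
(* Resetting [w'] to a unit at the trivial weight makes [mulext] multiplicative;
   nothing changes, as the trivial weight has multiplicity [0]. *)
rewrite m1 mul1r; pose w'' y := if y == 0 then 1 else w' y.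
have -> : mulext w' (push P T + chr 0) = Pn'.
  rewrite (@eq_mulext _ _ _ w'') => [|y]; last first.
    by rewrite mem_dom /w''; case: (y =P 0) => // ->; rewrite coef0 m1 subrr eqxx.
  have w''u y : w'' y \is a GRing.unit.
    by rewrite unitfE /w''; case: (y =P 0) => [_|/eqP y0]; [exact: oner_neq0 | exact: w'_neq0].
  rewrite mulextD // mulextU {2}/w'' eqxx mulr1 mulext_push //.
  rewrite /mulext (bigID ker) /= [X in X * _]big1 ?mul1r => [|x]; last first.
    by rewrite /ker /w'' => ->; rewrite exp1rz.
  by apply: eq_bigr => x; rewrite /ker /w'' => /negbTE->.
rewrite -[Pn'^-1]mulr1 -H'1; apply: specLM => //; by case: PnP.
Qed.
End Denominator.
End KernelOfRestriction.

(** The quotient of [todd_den (c *~ z)] by [c], which stays meaningful, with value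
    [z], when [c] is specialized to [0]. *)
Definition todd_ker (K : fieldType) (z : int) (c : K) : fps K :=
  Fps (fun n => - (- z%:~R) ^+ n.+1 * c ^+ n / n.+1`!%:R).

Lemma todd_den_mulz (K : fieldType) (z : int) (c : K) :
  todd_den (c *~ z) = monS c 0 * todd_ker z c.
Proof.
apply/fpsP => n; rewrite coef_monSM /= subn0 -[c *~ z]mulrzr -mulrN exprMn (exprS c n); ring.
Qed.

Section EulerClasses.
Variables (R : realType) (k k' : nat) (P : 'M[int]_(k, k')).
Variables (delta : 'rV[int]_k) (a : 'rV[int]_k -> int).
Hypothesis delta0 : delta != 0.
Hypothesis kerP : forall x, x *m P = 0 -> x = delta *~ a x.
Hypothesis deltaP : delta *m P = 0.
Hypothesis a_delta : a delta = 1.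
Variable T : vchar k.
Hypothesis T_ker : forall x, x *m P = 0 -> coeff x T <= 0.
Hypothesis T_delta : coeff delta T < 0.

Local Notation specK := (specK (restr R P)).
Local Notation specS := (specS (restr R P)).
Local Notation specL := (specL (restr R P)).
Local Notation e := (c1b R delta)%:F.

Lemma specK_int (z : int) : specK z%:~R z%:~R.
Proof. by have := specK_phi (restr R P) z%:~R; rewrite !rmorph_int. Qed.

Lemma specL_int (z : int) : specL z%:~R z%:~R.
Proof. by have := specL_cst P (z%:~R : R[i]); rewrite !rmorph_int. Qed.

Lemma specL_inv_euler :
  specL ((euler R T)^-1 / e)
    (if coeff 0 (push P T + chr 0) < 0 then 0 else (euler R (push P T + chr 0))^-1).
Proof.
apply: (specL_inv_mulext delta0 deltaP (w := fun x => (c1b R x)%:F)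
  (w' := fun y => (c1b R y)%:F) (h := fun x => (a x)%:~R)
  (h' := fun x => (a x)%:~R)) => //.
- by move=> x xP; apply: specU_c1b.
- by move=> y y0; rewrite tofrac_eq0 monS_eq0 c1_eq0.
- move=> x /kerP {1}->; rewrite -[_%:~R](rmorph_int (@tofrac _)) -rmorphM; congr (_ %:F).
  rewrite -(rmorph_int (@constS _)) /c1b c1Mz.
  by transitivity (monS (c1 R delta) 1 * monS (a x)%:~R 0); rewrite // monSM addn0 mulrzr.
- by move=> x _; apply: specL_int.
- by rewrite a_delta.
Qed.

Lemma specL_inv_ch_Lambda :
  specL ((ch_Lambda R T)^-1 / e)
    (if coeff 0 (push P T + chr 0) < 0 then 0 else (ch_Lambda R (push P T + chr 0))^-1).
Proof.
apply: (specL_inv_mulext delta0 deltaP (w := fun x => 1 - ch_char R (- x))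
  (w' := fun y => 1 - ch_char R (- y)) (h := fun x => (todd_ker (a x) (c1 R delta))%:F)
  (h' := fun x => (a x)%:~R)) => //.
- by move=> x xP; apply: specU_ch_Lambda.
- move=> y y0; rewrite ch_LambdaE mulf_neq0 ?monS_neq0 // tofrac_eq0.
  apply/eqP => /fpsP/(_ 0%N)/eqP.
  by rewrite /= expr1 opprK divr1 mul0rn c1_eq0 (negbTE y0).
- move=> x /kerP xE; rewrite ch_LambdaE {1}xE c1Mz -!rmorphM; congr (_ %:F).
  by rewrite todd_den_mulz mulrA monSM mul1r addn0.
- move=> x _; have -> : (a x)%:~R = (constS (a x)%:~R : fps (ratfun R k'))%:F :> laurent R k'.
    by rewrite !rmorph_int.
  apply: specL_fps => n.
  have -> : coefS (constS (a x)%:~R) n = coefS (todd_ker (a x) (0 : ratfun R k')) n.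
    case: n => [|n] /=; first by rewrite mulr1 opprK divr1 mulr1n.
    by rewrite expr0n mulr0 mul0r mulr0n.
  apply: specKM; last by apply: specKV; [exact/fact_neq0/ratfun_char0 | exact: specK_nat].
  apply: specKM; first exact/specKN/specKX/specKN/specK_int.
  by apply/specKX/specK_c1_ker.
- by rewrite a_delta.
Qed.
End EulerClasses.

(** * Diagonal weights of the tangent space *)

Section DiagonalOfPartitions.
Variable rho : Defs.partition.

Lemma nth_parts_anti i j : (i <= j)%N -> (nth 0 rho j <= nth 0 rho i)%N.
Proof.
move=> ij; have /andP[srt _] := partsP rho.
have [lt_j|] := ltnP j (size rho); last by move=> /(nth_default 0%N)->.
apply: (sorted_leq_nth (leT := geq)) => //; last exact: leq_ltn_trans ij lt_j.
- by move=> a b c ba cb; exact: leq_trans cb ba.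
- by move=> a; apply: leqnn.
Qed.

Definition in_diagram (i j : nat) : bool := (j < nth 0 rho i)%N.

Lemma in_diagram_down i j i' j' :
  (i' <= i)%N -> (j' <= j)%N -> in_diagram i j -> in_diagram i' j'.
Proof.
by move=> ii jj; rewrite /in_diagram => /(leq_ltn_trans jj) h; apply: leq_trans h (nth_parts_anti ii).
Qed.

(** Indexing all sums by one square that contains the diagram makes shifts by
    [(v, u)] harmless and lets differences telescope. *)
Definition side : nat := maxn (size rho) (nth 0 rho 0).

Lemma in_diagram_lt i j : in_diagram i j -> (i < side)%N && (j < side)%N.
Proof.
move=> ij; rewrite /side !leq_max; apply/andP; split.
  by apply/orP; left; rewrite ltnNge; apply: contraL ij => /(nth_default 0%N); rewrite /in_diagram => ->.
by apply/orP; right; exact: (leq_trans ij (nth_parts_anti (leq0n i))).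
Qed.

Local Notation f i j := ((in_diagram i j)%:R : int).

(** Since a diagram contains every box below one of its boxes, this also counts
    the pairs of boxes with difference [(v, u)]; see [pairs_beyond]. *)
Definition beyond (v u : nat) : int :=
  \sum_(i < side) \sum_(j < side) f (i + v)%N (j + u)%N.

Lemma f_side i j : (side <= i)%N || (side <= j)%N -> f i j = 0.
Proof.
case: (boolP (in_diagram i j)) => // /in_diagram_lt /andP[il jl].
by rewrite leqNgt il leqNgt jl.
Qed.

Lemma telescope_side (F : nat -> int) v : (forall i, (side <= i)%N -> F i = 0) ->
  \sum_(i < side) F (i + v)%N - \sum_(i < side) F (i + v.+1)%N = F v.
Proof.
move=> F0; have -> : \sum_(i < side) F (i + v)%N = \sum_(i < side.+1) F (i + v)%N.
  by rewrite big_ord_recr /= [X in _ + X]F0 ?addr0 // leq_addr.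
rewrite big_ord_recl add0n [X in _ + X - _](eq_bigr (fun i : 'I_side => F (i + v.+1)%N)) => [|i _].
  by rewrite addrK.
by rewrite /bump /= ?add1n addSnnS.
Qed.

(** The mixed second difference of a double tail sum is the summand at the
    corner; this is the only combinatorics behind the diagonal weights. *)
Lemma beyond_corner v u :
  beyond v u - beyond v u.+1 - (beyond v.+1 u - beyond v.+1 u.+1) = f v u.
Proof.
have row w : beyond w u - beyond w u.+1 = \sum_(i < side) f (i + w)%N u.
  rewrite /beyond -sumrB; apply: eq_bigr => i _.
  by rewrite (telescope_side (F := fun j => f (i + w)%N j)) // => j jl; rewrite f_side ?jl ?orbT.
by rewrite !row (telescope_side (F := fun i => f i u)) // => i il; rewrite f_side ?il.
Qed.

Lemma boxesE N k (W : weights N k) : boxes W rho =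
  \sum_(i < side) \sum_(j < side | in_diagram i j) chr (- (wt1 W *+ j) - wt2 W *+ i).
Proof.
rewrite /boxes.
have sz : (size rho <= side)%N by rewrite leq_maxl.
rewrite (big_ord_widen side (fun i => \sum_(j < nth 0%N rho i) chr (- (wt1 W *+ j) - wt2 W *+ i)) sz).
rewrite big_mkcond; apply: eq_bigr => i _; case: ltnP => si; last first.
  rewrite big1 // => j; rewrite /in_diagram nth_default //.
have le_n : (nth 0%N rho i <= side)%N.
  by rewrite (leq_trans (nth_parts_anti (leq0n i))) // leq_maxr.
by rewrite (big_ord_widen side (fun j => chr (- (wt1 W *+ j) - wt2 W *+ i)) le_n).
Qed.
End DiagonalOfPartitions.

Section TangentWeights.
Variables (N M : nat).
Local Notation W := (full_torus N M).
Implicit Types (u v : int) (pi : N.-tuple Defs.partition).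

Definition t_char u v : 'rV[int]_(2 + N + M) := wt1 W *~ u + wt2 W *~ v.

Lemma t_charB u v u' v' : t_char u v - t_char u' v' = t_char (u - u') (v - v').
Proof. by rewrite /t_char !mulrzBr opprD addrACA. Qed.

Lemma t_char_y_eq u v u' v' i j :
  (t_char u v == t_char u' v' - (wy W j - wy W i)) = (u == u') && (v == v') && (i == j).
Proof.
apply/eqP/idP => [/rowP E|/andP[/andP[/eqP-> /eqP->] /eqP->]]; last by rewrite subrr subr0.
have scal (A : 'rV[int]_(2 + N + M)) (z : int) l : (A *~ z) 0 l = A 0 l * z.
  by rewrite -scaler_int !mxE intz mulrC.
have Eu := E (lshift M (lshift N 0)); have Ev := E (lshift M (lshift N 1)).
have Ey := E (lshift M (rshift 2 j)); move: Eu Ev Ey.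
rewrite !(scal, mxE) !eqxx /= !(mul1r, mul0r, subr0, addr0, add0r).
move=> -> ->; rewrite !eqxx (inj_eq (@lshift_inj _ _)) (inj_eq (@rshift_inj _ _)) eq_sym /=.
by case: eqP => // _ /eqP; rewrite subr0 eq_sym oppr_eq0 oner_eq0.
Qed.

Lemma boxes_t_char (rho : Defs.partition) : boxes W rho =
  \sum_(i < side rho) \sum_(j < side rho | in_diagram rho i j)
    chr (t_char (- j%:Z) (- i%:Z)).
Proof.
rewrite boxesE; apply: eq_bigr => i _; apply: eq_bigr => j _.
by rewrite /t_char !mulrNz !pmulrn.
Qed.

Local Notation f rho i j := ((in_diagram rho i j)%:R : int).

Lemma coeff_boxes (rho : Defs.partition) u v i j :
  coeff (t_char u v - (wy W j - wy W i)) (boxes W rho) =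
    \sum_(r < side rho) \sum_(c < side rho)
      f rho r c * [&& - c%:Z == u, - r%:Z == v & i == j]%:R.
Proof.
rewrite boxes_t_char raddf_sum; apply: eq_bigr => r _.
rewrite raddf_sum big_mkcond /=; apply: eq_bigr => c _.
by case: in_diagram; rewrite ?mul0r // mul1r coeffU mul1r t_char_y_eq andbA.
Qed.

(** The multiplicity of [t1^u t2^v] in [Q^* Q'], for the box characters [Q] and
    [Q'] of two partitions. *)
Definition pairs (rho sigma : Defs.partition) u v : int :=
  \sum_(r < side rho) \sum_(c < side rho) \sum_(r' < side sigma) \sum_(c' < side sigma)
    f rho r c * f sigma r' c' * (((c%:Z - c'%:Z == u) && (r%:Z - r'%:Z == v)))%:R.

Lemma coeff_boxes_pair (rho sigma : Defs.partition) u v i j :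
  coeff (t_char u v - (wy W j - wy W i)) (vmul (vbar (boxes W rho)) (boxes W sigma)) =
    pairs rho sigma u v * (i == j)%:R.
Proof.
rewrite !boxes_t_char vbar_sum vmul_suml raddf_sum mulr_suml; apply: eq_bigr => r _.
rewrite vbar_sum vmul_suml raddf_sum big_mkcond mulr_suml /=; apply: eq_bigr => c _.
case: ifP => frc; last by rewrite !big1 ?mul0r // => r' _; rewrite big1 // => c' _; rewrite !mul0r.
rewrite vbarU vmul_sumr raddf_sum mulr_suml /=; apply: eq_bigr => r' _.
rewrite vmul_sumr raddf_sum big_mkcond mulr_suml /=; apply: eq_bigr => c' _.
case: ifP => frc'; last by rewrite !(mulr0, mul0r).
rewrite vmulU coeffU !mul1r addrC t_charB t_char_y_eq !opprK addrC [X in _ && (X == _) && _]addrC.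
by rewrite -natrM mulnb.
Qed.

Lemma sum_side_pick rho (F : nat -> int) (a : nat) :
  (forall i, (side rho <= i)%N -> F i = 0) ->
  \sum_(i < side rho) F i * (i == a :> nat)%:R = F a.
Proof.
move=> F0; have [lt_a|/F0 Fa] := ltnP a (side rho).
  rewrite (bigD1 (Ordinal lt_a)) //= eqxx mulr1 big1 ?addr0 // => i /negbTE ia.
  by rewrite -[(i == a :> nat)]/(i == Ordinal lt_a) ia mulr0.
by rewrite Fa big1 // => i _; case: eqP => [->|_]; rewrite ?Fa ?mul0r ?mulr0.
Qed.

(** For a nonnegative shift, a box and its shift both lie in the diagram as soon as
    the shift does. *)
Lemma pairs_beyond rho (u v : nat) : pairs rho rho u%:Z v%:Z = beyond rho v u.
Proof.
have shift (a b w : nat) : (a%:Z - b%:Z == w%:Z) = (a == (b + w)%N).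
  by rewrite subr_eq -PoszD eqz_nat addnC.
rewrite /pairs.
under eq_bigr => r _ do rewrite exchange_big.
rewrite exchange_big /=; apply: eq_bigr => r' _.
under eq_bigr => r _ do rewrite exchange_big.
rewrite exchange_big /=; apply: eq_bigr => c' _.
transitivity (\sum_(r < side rho) (f rho r (c' + u)%N * f rho r' c') * (r == (r' + v)%N :> nat)%:R).
  apply: eq_bigr => r _.
  rewrite -(sum_side_pick (rho := rho)
    (F := fun c => f rho r c * f rho r' c' * (r == (r' + v)%N :> nat)%:R)) => [|c cl].
    by apply: eq_bigr => c _; rewrite !shift andbC -mulnb natrM mulrA.
  by rewrite f_side ?cl ?orbT // !mul0r.
rewrite (sum_side_pick (rho := rho) (F := fun r => f rho r (c' + u)%N * f rho r' c')) => [|r rl].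
  case: (boolP (in_diagram rho (r' + v) (c' + u))) => [d|_]; last by rewrite mul0r.
  by rewrite mul1r (in_diagram_down _ _ d) // leq_addr.
by rewrite f_side ?rl // mul0r.
Qed.

Lemma pairs_opp rho u v : pairs rho rho (- u) (- v) = pairs rho rho u v.
Proof.
rewrite /pairs.
under eq_bigr => r _ do rewrite exchange_big.
rewrite exchange_big /=; apply: eq_bigr => r' _.
under eq_bigr => r _ do rewrite exchange_big.
rewrite [RHS]exchange_big /=; apply: eq_bigr => r _.
apply: eq_bigr => c' _; apply: eq_bigr => c _; rewrite [in RHS](mulrC (f _ _ _)).
by rewrite -[in LHS]opprB eqr_opp -[in LHS](opprB r'%:Z) eqr_opp.
Qed.

(** The multiplicity of [(t1 t2)^a] in [(1 - t1)(1 - t2) Q^* Q']. *)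
Definition pairs_corner rho sigma (a : int) : int :=
  pairs rho sigma a a - pairs rho sigma a (a - 1)
    - (pairs rho sigma (a - 1) a - pairs rho sigma (a - 1) (a - 1)).

Lemma pairs_corner_pos rho (b : nat) : pairs_corner rho rho b.+1%:Z = f rho b b.
Proof.
rewrite /pairs_corner; have -> : b.+1%:Z - 1 = b%:Z by rewrite intS addrAC subrr add0r.
rewrite !pairs_beyond -beyond_corner; ring.
Qed.

Lemma pairs_corner_neg rho (b : nat) : pairs_corner rho rho (- b%:Z) = f rho b b.
Proof.
rewrite /pairs_corner; have -> : - b%:Z - 1 = - b.+1%:Z by rewrite -opprD intS addrC.
rewrite !pairs_opp !pairs_beyond -beyond_corner; ring.
Qed.

(** The factor [y_i^-1 y_j] is trivial only for [i = j], so only the diagonal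
    blocks can contain characters of [t1] and [t2] alone. *)
Lemma coeff_Tvir_block (rho sigma : Defs.partition) a i j :
  coeff (t_char a a)
    (vmul (boxes W sigma - vmul (vmul (chr 0 - chr (wt1 W)) (chr 0 - chr (wt2 W)))
                                (vmul (vbar (boxes W rho)) (boxes W sigma)))
          (chr (wy W j - wy W i))) =
  coeff (t_char a a - (wy W j - wy W i)) (boxes W sigma)
    - pairs_corner rho sigma a * (i == j)%:R.
Proof.
rewrite coeff_vmul_chrr coeffB; congr (_ - _).
set X := vmul (vbar _) _.
have w1 : wt1 W = t_char 1 0 by rewrite /t_char addr0.
have w2 : wt2 W = t_char 0 1 by rewrite /t_char add0r.
have w12 : wt1 W + wt2 W = t_char 1 1 by [].
have shift u v : coeff (t_char a a - (wy W j - wy W i) - t_char u v) X =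
    pairs rho sigma (a - u) (a - v) * (i == j)%:R.
  by rewrite addrAC t_charB coeff_boxes_pair.
rewrite !(vmulDl, vmulNl, vmulDr, vmulNr, vmulU, add0r, addr0).
rewrite !(coeffD, coeffN, coeff_vmul_chrl) w12 w1 w2 !shift !subr0 coeff_boxes_pair.
rewrite /pairs_corner; ring.
Qed.

Lemma boxes_diag_neg rho (b : nat) :
  \sum_(r < side rho) \sum_(c < side rho)
    f rho r c * [&& - c%:Z == - b%:Z, - r%:Z == - b%:Z & true]%:R = f rho b b.
Proof.
rewrite -(sum_side_pick (rho := rho) (F := fun r => f rho r b) b) => [|r rl]; last first.
  by rewrite f_side ?rl.
apply: eq_bigr => r _.
rewrite -(sum_side_pick (rho := rho) (F := fun c => f rho r c * (r == b :> nat)%:R)) => [|c cl].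
  by apply: eq_bigr => c _; rewrite andbT !eqr_opp !eqz_nat andbC -mulnb natrM mulrA.
by rewrite f_side ?cl ?orbT // mul0r.
Qed.

Lemma boxes_diag_pos rho (b : nat) :
  \sum_(r < side rho) \sum_(c < side rho)
    f rho r c * [&& - c%:Z == b.+1%:Z, - r%:Z == b.+1%:Z & true]%:R = 0.
Proof.
rewrite big1 // => r _; rewrite big1 // => c _.
by rewrite (_ : (- c%:Z == b.+1%:Z) = false) ?mulr0 //; case: (nat_of_ord c).
Qed.

(** For [a <= 0] the diagonal box [(- a, - a)] contributes to [Q] and, by the
    symmetry of [Q^* Q], also to [(1 - t1)(1 - t2) Q^* Q], and cancels; for
    [a > 0] only the second contribution exists. *)
Lemma coeff_Tvir a pi : coeff (t_char a a) (Tvir W pi) =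
  - \sum_(i < N) if a is Posz b.+1 then f (tnth pi i) b b else 0.
Proof.
have block i j := coeff_Tvir_block (tnth pi i) (tnth pi j) a i j.
rewrite /Tvir raddf_sum -sumrN; apply: eq_bigr => i _.
transitivity (\sum_(j < N) (coeff (t_char a a - (wy W j - wy W i)) (boxes W (tnth pi j))
    - pairs_corner (tnth pi i) (tnth pi j) a * (i == j)%:R)).
  by rewrite raddf_sum; apply: eq_bigr => j _; rewrite -block.
under eq_bigr => j _ do rewrite coeff_boxes.
rewrite (bigD1 i) //= [X in _ + X]big1 ?addr0 => [|j ji]; last first.
  rewrite eq_sym (negbTE ji) mulr0 subr0.
  by rewrite big1 // => r _; rewrite big1 // => c _; rewrite !andbF mulr0.
rewrite eqxx mulr1.
set rho := tnth pi i; case: a {block} => [[|b]|b].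
- by rewrite -[Posz 0]/(- 0%N%:Z) pairs_corner_neg boxes_diag_neg subrr oppr0.
- by rewrite boxes_diag_pos pairs_corner_pos sub0r.
- by rewrite NegzE pairs_corner_neg boxes_diag_neg subrr oppr0.
Qed.

Lemma coeff_Tvir_le0 a pi : coeff (t_char a a) (Tvir W pi) <= 0.
Proof.
rewrite coeff_Tvir oppr_le0; apply: sumr_ge0 => i _.
by case: a => [[|b]|b] //; exact: ler0n.
Qed.

Lemma coeff_Tvir_lt0 pi : (0 < mpsize pi)%N -> coeff (t_char 1 1) (Tvir W pi) < 0.
Proof.
move=> pi0; rewrite coeff_Tvir oppr_lt0.
have [i pi_i] : exists i, (0 < psize (tnth pi i))%N.
  apply/existsP; apply: contraLR pi0 => /existsPn pi0; rewrite -leqNgt leqn0 /mpsize.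
  by rewrite sum_nat_eq0; apply/forallP => i; rewrite -leqn0 leqNgt pi0.
rewrite (bigD1 i) //= ltr_wpDr ?sumr_ge0 //.
rewrite (_ : in_diagram _ 0 0) //; move: pi_i; rewrite /in_diagram /psize.
have /andP[_] := partsP (tnth pi i).
by case: (parts (tnth pi i)) => [|p s] //=; rewrite inE negb_or eq_sym -lt0n => /andP[].
Qed.
End TangentWeights.

(** * The subtorus t1 t2 = 1 *)

Section TorusRestriction.
Variables (N M : nat).
Local Notation W := (full_torus N M).
Local Notation W' := (cy_torus N M).

(** Restriction of characters to the subtorus [t1 t2 = 1], so [t2] becomes
    [t1^-1]. *)
Definition res_mx : 'M[int]_(2 + N + M, 1 + N + M) :=
  block_mx (block_mx (\matrix_(i < 2, j < 1) (if i == 0 then 1 else -1)) 0 0 1%:M) 0 0 1%:M.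

(** A section of [res_mx], used to extend a class on the subtorus to the full
    torus without changing its rank. *)
Definition lift_mx : 'M[int]_(1 + N + M, 2 + N + M) :=
  block_mx (block_mx (delta_mx 0 0) 0 0 1%:M) 0 0 1%:M.

Lemma lift_mxK : lift_mx *m res_mx = 1%:M.
Proof.
rewrite /lift_mx /res_mx !mulmx_block !(mul0mx, mulmx0, mul1mx, mulmx1, addr0, add0r).
have -> : delta_mx 0 0 *m (\matrix_(i < 2, j < 1) (if i == 0 then 1 else -1)) = 1%:M :> 'M[int]_1.
  by rewrite -rowE; apply/rowP => j; rewrite !mxE !ord1.
by rewrite -!scalar_mx_block.
Qed.

Lemma res_wt1 : wt1 W *m res_mx = wt1 W'.
Proof.
rewrite -rowE; apply/rowP => j; rewrite mxE /res_mx col_mxEu.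
case: (split_ordP j) => {j} j ->; last by rewrite row_mxEr !mxE eq_rlshift.
rewrite row_mxEl col_mxEu; case: (split_ordP j) => {j} j ->.
  by rewrite row_mxEl !mxE ord1 eqxx.
by rewrite row_mxEr !mxE !(inj_eq (@lshift_inj _ _)) eq_rlshift.
Qed.

Lemma res_wt2 : wt2 W *m res_mx = wt2 W'.
Proof.
rewrite -rowE; apply/rowP => j; rewrite mxE /res_mx col_mxEu.
case: (split_ordP j) => {j} j ->; last by rewrite row_mxEr !mxE eq_rlshift oppr0.
rewrite row_mxEl col_mxEu; case: (split_ordP j) => {j} j ->.
  by rewrite row_mxEl !mxE ord1 eqxx.
by rewrite row_mxEr !mxE !(inj_eq (@lshift_inj _ _)) eq_rlshift oppr0.
Qed.

Lemma res_wy i : wy W i *m res_mx = wy W' i.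
Proof.
rewrite -rowE; apply/rowP => j; rewrite mxE /res_mx col_mxEu.
case: (split_ordP j) => {j} j ->; last by rewrite row_mxEr !mxE eq_rlshift.
rewrite row_mxEl col_mxEd; case: (split_ordP j) => {j} j ->.
  by rewrite row_mxEl !mxE !(inj_eq (@lshift_inj _ _)) eq_lrshift.
by rewrite row_mxEr !mxE !(inj_eq (@lshift_inj _ _)) !(inj_eq (@rshift_inj _ _)) eq_sym.
Qed.

Definition t1t2 : 'rV[int]_(2 + N + M) := wt1 W + wt2 W.

Lemma t_char_diag a : t_char N M a a = t1t2 *~ a.
Proof. by rewrite /t_char /t1t2 mulrzDl. Qed.

Lemma res_t1t2 : t1t2 *m res_mx = 0.
Proof. by rewrite /t1t2 mulmxDl res_wt1 res_wt2 addrN. Qed.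

Definition diag_exp (x : 'rV[int]_(2 + N + M)) : int := x 0 (lshift M (lshift N 0)).

Lemma diag_exp_t1t2 : diag_exp t1t2 = 1.
Proof. by rewrite /diag_exp !mxE !eqxx. Qed.

Lemma t1t2_neq0 : t1t2 != 0.
Proof. by apply/eqP => K0; have := diag_exp_t1t2; rewrite K0 /diag_exp mxE. Qed.

Lemma res_ker x : x *m res_mx = 0 -> x = t1t2 *~ diag_exp x.
Proof.
rewrite -{1}[x]hsubmxK -{1}[lsubmx x]hsubmxK /res_mx !mul_row_block.
rewrite !(mulmx0, mulmx1, addr0, add0r) -[0 in RHS]row_mx0.
move/eq_row_mx => [+ x2]; rewrite -[0 in RHS]row_mx0 => /eq_row_mx[x0 x1].
have x01 : x 0 (lshift M (lshift N 0)) = x 0 (lshift M (lshift N 1)).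
  move/rowP/(_ 0): x0; rewrite !mxE !big_ord_recl big_ord0 !mxE /= mulr1 addr0 mulrN1.
  move/eqP; rewrite subr_eq0 => /eqP->; congr (x 0 (lshift _ (lshift _ _))).
  exact: val_inj.
apply/rowP => l; rewrite -t_char_diag /t_char -!scaler_int !mxE.
case: (split_ordP l) => {l} l ->; last first.
  by move/rowP/(_ l): x2; rewrite !mxE !eq_rlshift !mulr0 addr0.
rewrite !(inj_eq (@lshift_inj _ _)); case: (split_ordP l) => {l} l ->; last first.
  by move/rowP/(_ l): x1; rewrite !mxE !eq_rlshift !mulr0 addr0.
rewrite !(inj_eq (@lshift_inj _ _)) intz /diag_exp.
case: (l =P 0) => [->|l0] /=; first by rewrite mulr1 mulr0 addr0.
have -> : l = 1.
  apply: val_inj; case: l l0 => [[|[|//]] // i []]; exact: val_inj.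
by rewrite eqxx mulr0 mulr1 add0r.
Qed.

Local Notation res := (push res_mx).

Lemma res_boxes rho : res (boxes W rho) = boxes W' rho.
Proof.
rewrite /boxes push_sum; apply: eq_bigr => i _; rewrite push_sum; apply: eq_bigr => j _.
rewrite pushU mulmxBl mulNmx; congr (chr (- _ - _)).
  by rewrite -res_wt1 -[_ *m _]/(mulmxr _ _) raddfMn.
by rewrite -res_wt2 -[_ *m _]/(mulmxr _ _) raddfMn.
Qed.

Lemma res_chrB x y : res (chr (x - y)) = chr (x *m res_mx - y *m res_mx).
Proof. by rewrite pushU mulmxBl. Qed.

Lemma res_Tvir pi : res (Tvir W pi) = Tvir W' pi.
Proof.
rewrite /Tvir push_sum; apply: eq_bigr => i _; rewrite push_sum; apply: eq_bigr => j _.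
rewrite push_vmul res_chrB !res_wy pushD pushN !push_vmul push_vbar !res_boxes.
by rewrite !pushD !pushN !pushU !mul0mx res_wt1 res_wt2.
Qed.

Lemma res_taut alpha pi : res (taut W alpha pi) = taut W' (res alpha) pi.
Proof.
rewrite /taut push_sum; apply: eq_bigr => i _.
by rewrite !push_vmul pushU res_wy res_boxes.
Qed.

Lemma res_tangent_S : res (tangent_S W) = tangent_S W'.
Proof. by rewrite pushD !pushU res_wt1 res_wt2. Qed.

Lemma res_bundle_E : res (bundle_E W) = bundle_E W'.
Proof. by rewrite push_sum; apply: eq_bigr => i _; rewrite pushU res_wy. Qed.
End TorusRestriction.

(** * Restriction of (exp (e H) - 1) / e *)

Fact extract_factor (F : fieldType) (u e h m : F) : e != 0 ->
  u * (e * h * m) = e * (u / e * (e * (h * m))).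
Proof. by move=> e0; field. Qed.

Fact divide_ode (F : fieldType) (n e h s : F) : n != 0 -> e != 0 ->
  n^-1 * (n * (e * h) + e * s) / e = h + n^-1 * s.
Proof. by move=> n0 e0; field; rewrite n0 e0. Qed.

Section ExponentialQuotient.
Variables (A A' : idomainType) (phi : {rmorphism A -> A'}).
Local Notation L := {fraction (fps {fraction A})}.
Local Notation L' := {fraction (fps {fraction A'})}.
Hypothesis char0 : forall n, n.+1%:R != 0 :> {fraction A'}.

Lemma specU_nat n : specU phi n.+1%:R n.+1%:R.
Proof.
have natE (F : fieldType) : n.+1%:R = (monS n.+1%:R 0)%:F :> {fraction (fps F)}.
  by rewrite -[monS _ 0]/(constS _) !rmorph_nat.
rewrite !natE; apply: specU_unit; first exact/specS_const/specK_nat.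
by rewrite /= mulr1n.
Qed.

Variables (U G : fps L) (e : L) (H : nat -> L) (H' : nat -> L').
Hypothesis ode : qderiv U = U * qderiv G.
Hypothesis U0 : coefS U 0 = 1.
Hypothesis GE : forall n, coefS G n = e * H n.
Hypothesis e0 : e != 0.
Hypothesis char0L : forall n, n.+1%:R != 0 :> L.
Hypothesis e_spec : specL phi e 0.
Hypothesis H_spec : forall n, specL phi (H n) (H' n).

(** By the differential equation of the exponential, [U_n / e] differs from [H_n]
    by sums of products [(U_i / e) * (e * H_j)] with [0 < i < n]; inductively the
    first factor is regular, and the second restricts to [0]. *)
Lemma specL_exp_quotient n : specL phi (coefS U n.+1 / e) (H' n.+1).
Proof.
elim/ltn_ind: n => n IH.
pose S := \sum_(i < n.+1) (coefS U i.+1 / e) * (e * (H (n - i) * (n - i)%:R)).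
have -> : coefS U n.+1 / e = H n.+1 + (n.+1%:R)^-1 * S.
  have /fpsP/(_ n.+1) := ode; rewrite coefSM big_ord_recl U0 mul1r /= subn0 GE.
  have -> : \sum_(i < n.+1) coefS U (bump 0 i) * (coefS G (n.+1 - bump 0 i) *+ (n.+1 - bump 0 i))
      = e * S.
    rewrite /S mulr_sumr; apply: eq_bigr => i _; rewrite /bump /= add1n subSS GE.
    by rewrite -[_ *+ _]mulr_natr extract_factor.
  move=> eqU.
  have -> : coefS U n.+1 = (n.+1%:R)^-1 * (n.+1%:R * (e * H n.+1) + e * S).
    rewrite [n.+1%:R * (e * _)]mulr_natl -eqU -[coefS U _ *+ _]mulr_natl mulKf //.
    exact: char0L.
  by rewrite divide_ode // char0L.
rewrite -[H' _]addr0; apply: specLD; first exact: H_spec.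
rewrite -(mulr0 (n.+1%:R)^-1); apply: specLM; first by case: (specU_nat n).
have -> : 0 = \sum_(i < n.+1) (0 : L') by rewrite big1.
apply: specL_sum => i _; have [->|i_n] := eqVneq (i : nat) n.
  by rewrite subnn !mulr0; apply: specL0.
have lt_in : (i < n)%N by rewrite ltn_neqAle i_n -ltnS ltn_ord.
rewrite -(mulr0 (H' i.+1)); apply: specLM; first exact: IH.
rewrite -(mul0r (H' (n - i)%N * (n - i)%:R)); apply: specLM => //.
by apply: specLM; [exact: H_spec | exact: specL_nat].
Qed.
End ExponentialQuotient.

(** * The reduced series *)

Section ReducedSeries.
Variables (R : realType) (N M : nat).
Local Notation W := (full_torus N M).
Local Notation W' := (cy_torus N M).
Local Notation P := (res_mx N M).
Local Notation L := (laurent R (2 + N + M)).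
Local Notation L' := (laurent R (1 + N + M)).
Local Notation specL := (specL (restr R P)).
Local Notation e := (c1b R (t1t2 N M))%:F.

Lemma chern_class1_tangent : chern_class R 1 (tangent_S W) = e.
Proof.
rewrite /chern_class /tangent_S -[ctot R _]/(mulext _ _) mulextD; last exact: ctot_unit.
rewrite !mulextU coefSM !big_ord_recl big_ord0 /= !(mulr0n, mulr1n, mul0rn) !(addr0, add0r).
by rewrite mul1r mulr1 addrC /c1b /t1t2 c1D.
Qed.

Lemma specL_chern_triple alpha p :
  specL (chern_triple W R alpha p) (chern_triple W' R (push P alpha) p).
Proof.
rewrite /chern_triple -res_tangent_S -res_bundle_E.
by apply: specLM; [apply: specLM|]; apply: specL_chern_part.
Qed.

Lemma specL_intS x x' : specL x x' -> specL (Defs.intS W x) (Defs.intS W' x').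
Proof.
move=> xx'; rewrite /Defs.intS !invfM; apply: specLM => //.
have neq0 : wt1 W' != 0.
  apply/eqP => /rowP/(_ (lshift M (lshift N 0))).
  by rewrite !mxE !eqxx.
have [u1 v1] : specU (restr R P) (c1b R (wt1 W))%:F (c1b R (wt1 W'))%:F.
  by rewrite -res_wt1; apply: specU_c1b; rewrite res_wt1.
have [u2 v2] : specU (restr R P) (c1b R (wt2 W))%:F (c1b R (wt2 W'))%:F.
  by rewrite -res_wt2; apply: specU_c1b; rewrite res_wt2 oppr_eq0.
exact: specLM.
Qed.

(** Termwise comparison at the fixed points; the hypothesis on [den] is the one
    supplied by [specL_inv_euler] and [specL_inv_ch_Lambda]. *)
Lemma specL_series (num den : vchar (2 + N + M) -> L) (num' den' : vchar (1 + N + M) -> L')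
    alpha n :
  (forall g, specL (num g) (num' (push P g))) ->
  (forall T, (forall x, x *m P = 0 -> coeff x T <= 0) -> coeff (t1t2 N M) T < 0 ->
    specL ((den T)^-1 / e)
      (if coeff 0 (push P T + chr 0) < 0 then 0 else (den' (push P T + chr 0))^-1)) ->
  specL (coefS (vir_series W num den alpha) n.+1 / e)
    (coefS (red_series W' num' den' (push P alpha)) n.+1).
Proof.
move=> num_spec den_spec; rewrite /= !fsbig_finite; try exact: finite_mpsize.
rewrite mulr_suml big_seq [X in specL _ X]big_seq; apply: specL_sum => pi.
rewrite in_fset_set => [pi_n|]; last exact: finite_mpsize.
have /= pin := set_mem pi_n; rewrite /Tred -res_taut -res_Tvir.
have Tker x : x *m P = 0 -> coeff x (Tvir W pi) <= 0.
  by move=> /res_ker->; rewrite -t_char_diag coeff_Tvir_le0.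
have Tdelta : coeff (t1t2 N M) (Tvir W pi) < 0.
  by rewrite -[t1t2 N M]mulr1z -t_char_diag coeff_Tvir_lt0 ?pin.
have := den_spec _ Tker Tdelta; rewrite -mulrA; case: ifP => _ dP; last exact: specLM.
by rewrite -(mulr0 (num' (push P (taut W alpha pi)))); apply: specLM.
Qed.

(** In each degree the truncated product [U] satisfies [U_n / e |-> H'_n], and
    [U_n - F_n] tends to [0].  Dividing by [e] loses one power of [b], which is why
    the hypothesis is applied with [d.+1]. *)
Lemma log_sum_of_product (A : coef_family R) alpha (F : fps L) (F' : fps L') :
  universal_product W alpha A F ->
  coefS F' 0 = 0 ->
  (forall n, specL (coefS F n.+1 / e) (coefS F' n.+1)) ->
  universal_log_sum W' (push P alpha) A F'.
Proof.
move=> prodF F'0 FF' n d.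
have [D0 D0P] := prodF n d.+1; exists D0 => D leD.
have {D0P leD}[f fE] := D0P D leD.
have fin := finite_tsize D; rewrite fsbig_finite // in fE; rewrite fsbig_finite //.
set s := fset_set _ in fE *; set U := \prod_(p <- s) _ in fE.
pose g p := constS (Defs.intS W (chern_triple W R alpha p * e))
  * logS (mapS (@cst R _) (at_triple A p)).
pose G := \sum_(p <- s) g p.
pose H i := \sum_(p <- s) cst _ (coefS (logS (at_triple A p)) i) * Defs.intS W (chern_triple W R alpha p).
pose H' i := \sum_(p <- s) cst _ (coefS (logS (at_triple A p)) i)
  * Defs.intS W' (chern_triple W' R (push P alpha) p).
have H'E i : coefS (\sum_(p <- s) mapS (@cst R _) (logS (at_triple A p)) *
    constS (Defs.intS W' (chern_triple W' R (push P alpha) p))) i = H' i.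
  by rewrite coefS_sum; apply: eq_bigr => p _; rewrite mulrC constSM mulrC.
rewrite H'E; case: n => [|n] in fE *.
  exists 0; rewrite F'0 mulr0 tofrac0 /H' big1 ?subr0 // => p _.
  by rewrite coef0_logS rmorph0 mul0r.
have UG : U = \prod_(p <- s) expS (g p).
  by apply: eq_bigr => p _; rewrite chern_class1_tangent.
have g0 p : coefS (g p) 0 = 0 by rewrite /g constSM coef0_logS mulr0.
have e0 : e != 0 := e_neq0 R (t1t2_neq0 N M).
have quot : specL (coefS U n.+1 / e) (H' n.+1).
  apply: (specL_exp_quotient (@ratfun_char0 R _) (G := G) (H := H)).
  - rewrite UG; exact: (expS_ode_prod (@laurent_char0 R _) s g0).
  - by rewrite UG coef0_prod_expS.
  - move=> i; rewrite coefS_sum mulr_sumr; apply: eq_bigr => p _.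
    rewrite /g constSM -mapS_logS /Defs.intS /=; ring.
  - exact: e0.
  - exact: laurent_char0.
  - exact: specL_e (res_t1t2 N M).
  - move=> i; apply: specL_sum => p _; apply: specLM; first exact: specL_cst.
    exact/specL_intS/specL_chern_triple.
have := specLD quot (specLN (FF' n)); rewrite -mulrBl fE.
have -> : (monS 1 d.+1 * f)%:F / e = (monS 1 d * (monS (c1 R (t1t2 N M))^-1 0 * f))%:F.
  apply: (canLR (mulfK e0)); rewrite -rmorphM; congr (_ %:F).
  by apply: monS_shift; rewrite c1_eq0 t1t2_neq0.
exact: specL_small.
Qed.
End ReducedSeries.

Theorem theorem1p7 (R : realType) (N : nat) (r : int) (A B C : coef_family R) :
  is_universal r A (fun k (W : weights N k) alpha => Svir W R alpha) ->
  is_universal r B (fun k (W : weights N k) alpha => Vvir W R alpha) ->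
  is_universal r C (fun k (W : weights N k) alpha => Cvir W R alpha) ->
  forall (M : nat) (alpha : vchar (1 + N + M)), deg alpha = r ->
  [/\ universal_log_sum (cy_torus N M) alpha A (Sred (cy_torus N M) R alpha),
      universal_log_sum (cy_torus N M) alpha B (Vred (cy_torus N M) R alpha) &
      universal_log_sum (cy_torus N M) alpha C (Cred (cy_torus N M) R alpha)].
Proof.
move=> [_ prodA] [_ prodB] [_ prodC] M alpha deg_alpha.
pose alpha' := push (lift_mx N M) alpha.
have deg_alpha' : deg alpha' = r by rewrite deg_push.
have alphaE : alpha = push (res_mx N M) alpha' by rewrite push_comp lift_mxK push_id.
rewrite {}alphaE; split.
- apply: log_sum_of_product (prodA M _ deg_alpha') _ _ => // n; apply: specL_series => [g|T].
    by case: (specU_chern R (res_mx N M) g).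
  exact: (specL_inv_euler R (t1t2_neq0 N M) (@res_ker N M) (res_t1t2 N M) (diag_exp_t1t2 N M)).
- apply: log_sum_of_product (prodB M _ deg_alpha') _ _ => // n; apply: specL_series => [g|T].
    exact: specL_ch_det.
  exact: (specL_inv_ch_Lambda R (t1t2_neq0 N M) (@res_ker N M) (res_t1t2 N M) (diag_exp_t1t2 N M)).
- apply: log_sum_of_product (prodC M _ deg_alpha') _ _ => // n; apply: specL_series => [g|T].
    by case: (specU_chern R (res_mx N M) g).
  exact: (specL_inv_euler R (t1t2_neq0 N M) (@res_ker N M) (res_t1t2 N M) (diag_exp_t1t2 N M)).
Qed.
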